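(* Let $L,H,F,G$ satisfy the assumptions on the data listed in the context, let $\mu\in C([0,T];\mathcal P_1(\mathbb R^d))$, and let $\Delta=(\Delta t,\Delta x,\varepsilon)\in\,]0,\infty[^2\times]0,1[$ (with $T/\Delta t\in\mathbb N^*$). Then it holds that $$\big\langle D_x^2v^\Delta[\mu](t,x)y,y\big\rangle\le\widetilde C_{\rm hb}\Big(1+\frac{(\Delta x)^2}{\varepsilon^4}\Big)|y|^2\quad\text{for all }t\in[0,T],\ x,y\in\mathbb R^d,$$ where $\widetilde C_{\rm hb}>0$ is independent of $(\mu,\Delta)$.
   Context: **General notation.** $d\in\mathbb N$, $d\ge1$, $T>0$; $|\cdot|$ is the Euclidean norm on $\mathbb R^d$; $\overline B(0,r)$ is the closed Euclidean ball. $\mathcal P_1(\mathbb R^d)$ is the set of Borel probability measures with finite first moment, with the 1-Wasserstein distance $d_1$; $C([0,T];\mathcal P_1(\mathbb R^d))$ carries the uniform distance. **Assumptions on the data.** (1) $L:\mathbb R^d\times\mathbb R^d\to\mathbb R$ is $C^2$, bounded from below, and for some constants $C_{L,i}>0$ and all $x,a,b,y\in\mathbb R^d$: $L(x,a)\le C_{L,1}|a|^2+C_{L,2}$; $|D_xL(x,a)|\le C_{L,3}(1+|a|^2)$; $C_{L,4}|b|^2\le\langle D^2_{aa}L(x,a)b,b\rangle$; $\langle D^2_{xx}L(x,a)y,y\rangle\le C_{L,5}(1+|a|^2)|y|^2$. $H(x,p)=\sup_{a\in\mathbb R^d}(\langle a,p\rangle-L(x,a))$. (2) $F,G:\mathbb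 R^d\times\mathcal P_1(\mathbb R^d)\to\mathbb R$ are continuous and, for $h\in\{F,G\}$, there are constants $C_{h,i}>0$ such that for all $x,y\in\mathbb R^d$, $\nu\in\mathcal P_1(\mathbb R^d)$: $|h(x,\nu)|\le C_{h,1}$; $|h(x,\nu)-h(y,\nu)|\le C_{h,2}|x-y|$; $h(x+y,\nu)-2h(x,\nu)+h(x-y,\nu)\le C_{h,3}|y|^2$. **Semi-Lagrangian scheme.** Let $\mu\in C([0,T];\mathcal P_1(\mathbb R^d))$. With $X^{t,x,\alpha}(s)=x-\int_t^s\alpha(r)\,dr$ and $J^{t,x}[\mu](\alpha)=\int_t^T\big(L(X^{t,x,\alpha}(s),\alpha(s))+F(X^{t,x,\alpha}(s),\mu(s))\big)ds+G(X^{t,x,\alpha}(T),\mu(T))$, $C_{\rm b}>0$ is a fixed constant such that for every $\mu,t,x$ the infimum of $J^{t,x}[\mu]$ over $L^2([t,T];\mathbb R^d)$ is attained by some $\alpha$ with $\|\alpha\|_{L^\infty}\le C_{\rm b}$ (such a constant exists). $\Delta t=T/N$, $N\in\mathbb N^*$, $t_k=k\Delta t$, $\mathcal I^*_{\Delta t}=\{0,\dots,N-1\}$; $\Delta x>0$, $x_i=i\Delta x$ for $i\in\mathbb Z^d$. $\beta^1_i(z)=\prod_{l=1}^d\max\{0,1-|z_l/\Delta x-i_l|\}$, and $I^1[\phi](x)=\sum_{i\in\mathbb Z^d}\phi_i\beta_i^1(x)$ for $\phi=(\phi_i)_{i\in\mathbb Z^d}$. Define $v_{N,i}=G(x_i,\mu(T))$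 and, for $k\in\mathcal I^*_{\Delta t}$, $v_{k,i}=\inf_{a\in\overline B(0,C_{\rm b})}\big[\Delta tL(x_i,a)+I^1[v_{k+1}](x_i-\Delta t\,a)\big]+\Delta tF(x_i,\mu(t_k))$. Set $v^{\Delta t,\Delta x}[\mu](t,x)=I^1[v_k](x)$ for $t\in[t_k,t_{k+1}[$, $k\in\mathcal I_{\Delta t}^*$, and $v^{\Delta t,\Delta x}[\mu](T,x)=I^1[v_N](x)$. **Mollification.** $\rho\in C^\infty(\mathbb R^d)$ is a fixed function with bounded derivatives of any order, $\rho\ge0$ and $\int_{\mathbb R^d}\rho(x)dx=1$; $\rho_\varepsilon(x)=\varepsilon^{-d}\rho(x/\varepsilon)$. For $\Delta=(\Delta t,\Delta x,\varepsilon)$, $v^\Delta[\mu](t,\cdot)=\rho_\varepsilon*v^{\Delta t,\Delta x}[\mu](t,\cdot)$.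
   Formalization: The mollifier ρ is assumed to have derivatives of every order that are not only bounded but also Lebesgue integrable; with bounded derivatives alone, the mollified function may fail to be twice differentiable and the bound fails. *)

(* Defs.v *)
From HB Require Import structures.
From mathcomp Require Import all_boot all_order all_algebra.
From mathcomp Require Import all_classical all_reals all_analysis.
From mathcomp Require Import measurable_realfun.

Set Implicit Arguments.
Unset Strict Implicit.
Unset Printing Implicit Defensive.
Import Order.TTheory GRing.Theory Num.Theory.
Import numFieldTopology.Exports numFieldNormedType.Exports.

Local Open Scope classical_set_scope.
Local Open Scope ring_scope.

Notation borelRd R n := (g_sigma_algebraType [set A : set 'rV[R]_n | open A]).

(* Lebesgue measure on row vectors, by induction on the dimension: the image of
   the product measure on R x 'rV_n under the identification with 'rV_(1 + n). *)
Definition cons_rV (R : realType) (n : nat) (z : measurableTypeR R * borelRd R n) :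
  borelRd R n.+1 := row_mx z.1%:M (z.2 : 'rV[R]_n) : 'rV[R]_(1 + n).

Definition uncons_rV (R : realType) (n : nat) (v : borelRd R n.+1) :
  measurableTypeR R * borelRd R n :=
  ((v : 'rV[R]_n.+1) 0 0, rsubmx (v : 'rV[R]_(1 + n))).

Lemma uncons_rVK (R : realType) (n : nat) :
  cancel (@uncons_rV R n) (@cons_rV R n).
Proof.
move=> v; rewrite /cons_rV /uncons_rV /=.
rewrite (_ : _%:M = lsubmx (v : 'rV[R]_(1 + n))).
  exact: (@hsubmxK _ 1 1 n v).
apply/matrixP => i j; rewrite !mxE !ord1 eqxx mulr1n.
by congr (fun_of_matrix v _ _); apply/val_inj.
Qed.

Lemma cons_rVK (R : realType) (n : nat) :
  cancel (@cons_rV R n) (@uncons_rV R n).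
Proof.
case=> r v; rewrite /uncons_rV /cons_rV /=; congr (_, _); last exact: row_mxKr.
transitivity ((row_mx r%:M v : 'rV[R]_(1 + n)) 0 (@lshift 1 n 0)).
  by congr (fun_of_matrix _ _ _); apply/val_inj.
by rewrite row_mxEl mxE eqxx mulr1n.
Qed.

Lemma ball_cons_rV (R : realType) (n : nat) (x z : R * 'rV[R]_n) (e : R) :
  0 < e -> `|x.1 - z.1| < e -> ball x.2 e z.2 ->
  ball (cons_rV x : 'rV[R]_n.+1) e (cons_rV z).
Proof.
move=> e0 h1 [_ h2]; split => // i j.
rewrite /cons_rV -(@fintype.splitK 1 n j) /ball /=; case: (@fintype.split 1 n j) => k /=.
  rewrite !(@row_mxEl _ 1 1 n).
  by rewrite !mxE !ord1 eqxx !mulr1n.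
by rewrite !(@row_mxEr _ 1 1 n); have := h2 i k.
Qed.

Lemma measurable_cons_rV (R : realType) (n : nat) :
  measurable_fun [set: measurableTypeR R * borelRd R n] (@cons_rV R n).
Proof.
apply: (@measurability _ _ _ (borelRd R n.+1) setT _
  [set A : set 'rV[R]_n.+1 | open A] erefl).
move=> _ [U oU <-]; rewrite setTI.
pose q (i : rat * 'rV[rat]_n * nat) : R * 'rV[R]_n :=
  (ratr i.1.1, map_mx ratr i.1.2).
pose D := [set i : rat * 'rV[rat]_n * nat |
  forall z : R * 'rV[R]_n, `|(q i).1 - z.1| < i.2.+1%:R^-1 ->
    ball (q i).2 i.2.+1%:R^-1 z.2 -> U (cons_rV z)].
pose B (i : rat * 'rV[rat]_n * nat) : set (measurableTypeR R * borelRd R n) :=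
  if i \in D then
  (ball (q i).1 i.2.+1%:R^-1) `*`
    (ball (q i).2 i.2.+1%:R^-1 : set (borelRd R n)) else set0.
suff -> : @cons_rV R n @^-1` U = \bigcup_i B i.
  apply: countable_bigcupT_measurable => // i.
  rewrite /B; case: ifPn => // _; apply: measurableX; first 
    by apply: open_measurable; exact: ball_open.
  by apply: sub_sigma_algebra; exact: ball_open.
apply/seteqP; split => [z Uz|z [i _]]; last first.
  rewrite /B; case: ifPn => // /set_mem Di [h1 h2]; exact: Di.
have := oU _ Uz; rewrite -nbhs_ballE => -[e /= e0 eU].
pose k := Num.truncn (2 / e).
have ke : 2 * k.+1%:R^-1 < e.
  have : 2 / e < k.+1%:R by exact: truncnS_gt.
  by rewrite ltr_pdivrMr // mulrC => h; rewrite ltr_pdivrMr.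
set d : R := k.+1%:R^-1 in ke *.
have d0 : 0 < d by rewrite invr_gt0.
have ex (r : R) : exists p : rat, `|ratr p - r| < d.
  have [|p] := @rat_in_itvoo _ (r - d) (r + d).
    by rewrite ltrD2l gtrN.
  by rewrite in_itv /= -ltr_distl => h; exists p.
have [a ha] := ex z.1.
have {}ex (r : R) : {p : rat | `|ratr p - r| < d} by exact: cid.
pose w : 'rV[rat]_n := \row_j sval (ex ((z.2 : 'rV[R]_n) 0 j)).
have hw : ball (map_mx ratr w : 'rV[R]_n) d (z.2 : 'rV[R]_n).
  split=> // i j; rewrite !mxE ord1 /ball /=.
  by case: (ex _).
exists (a, w, k) => //; rewrite /B mem_set //= => y h1 h2.
apply: eU; apply: ball_cons_rV => //.
  apply: lt_trans ke; rewrite -(subrK (ratr a) z.1) -addrA mulr_natl mulr2n.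
  by rewrite (le_lt_trans (ler_normD _ _))// ltrD// distrC.
apply: (@le_ball _ _ _ (2 * d)); first exact: ltW.
rewrite mulr_natl mulr2n; apply: (ball_triangle _ h2).
exact: ball_sym.
Qed.

Lemma measurable_uncons_rV (R : realType) (n : nat) :
  measurable_fun [set: borelRd R n.+1] (@uncons_rV R n).
Proof.
apply/measurable_fun_pairP; split.
  apply: (measurability _ (RGenOpens.measurableE R)) => //.
  move=> _ [_ [a [b ->]] <-]; rewrite setTI; apply: sub_sigma_algebra.
  apply: (@open_comp 'rV[R]_n.+1 R (fun v => v 0 0)) => [v _|].
    exact: coord_continuous.
  exact: interval_open.
apply: (@measurability _ _ _ (borelRd R n) setT _
  [set A : set 'rV[R]_n | open A] erefl).
move=> _ [U oU <-]; rewrite setTI; apply: sub_sigma_algebra.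
apply: (@open_comp 'rV[R]_n.+1 'rV[R]_n
  (fun v => rsubmx (v : 'rV[R]_(1 + n)))) => // v _.
move=> A /= /nbhs_ballP[e e0 eA]; apply/nbhs_ballP; exists e => // w [_ vw].
by apply: eA; split => // i j; rewrite !mxE; exact: vw.
Qed.

Section lebesgueRd_step.
Context (R : realType) (n : nat).
Variable m : {sigma_finite_measure set (borelRd R n) -> \bar R}.

Let prod_measure :
    {measure set (measurableTypeR R * borelRd R n)%type -> \bar R} :=
  (lebesgue_measure \x m)%E.

Definition lebesgueRd_step (A : set (borelRd R n.+1)) : \bar R :=
  (lebesgue_measure \x m)%E (@cons_rV R n @^-1` A).

Let step0 : lebesgueRd_step set0 = 0%E.
Proof. by rewrite /lebesgueRd_step preimage_set0; exact: (measure0 prod_measure). Qed.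

Let step_ge0 A : (0 <= lebesgueRd_step A)%E.
Proof. exact: (measure_ge0 prod_measure). Qed.

Let step_sigma_additive : semi_sigma_additive lebesgueRd_step.
Proof.
move=> F mF tF mUF; rewrite /lebesgueRd_step preimage_bigcup.
have mc A : measurable A -> measurable (@cons_rV R n @^-1` A).
  by move=> mA; rewrite -[X in measurable X]setTI; exact: measurable_cons_rV.
apply: (@measure_semi_sigma_additive _ _ _ prod_measure) => [i||].
- exact: mc.
- apply/trivIsetP => /= i j _ _ ij; rewrite -preimage_setI.
  by move/trivIsetP : tF => /(_ _ _ _ _ ij) ->//; rewrite preimage_set0.
- by rewrite -preimage_bigcup; exact: mc.
Qed.

HB.instance Definition _ := isMeasure.Build _ _ _ lebesgueRd_step
  step0 step_ge0 step_sigma_additive.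

Let step_sigma_finite : sigma_finite setT lebesgueRd_step.
Proof.
have /sigma_finiteP[F [FT ndF Foo]] :=
  sigma_finiteT (lebesgue_measure :
    {sigma_finite_measure set (measurableTypeR R) -> \bar R}).
have /sigma_finiteP[G [GT ndG Goo]] := sigma_finiteT m.
exists (fun i => @uncons_rV R n @^-1` (F i `*` G i)).
  rewrite -preimage_bigcup (_ : \bigcup_i _ = setT) ?preimage_setT//.
  apply/seteqP; split => // -[r v] _.
  have : [set: measurableTypeR R] r by [].
  have : [set: borelRd R n] v by [].
  rewrite FT GT => -[k _ Gk] [l _ Fl]; exists (maxn k l) => //; split => /=.
    by move: r Fl; exact/subsetPset/ndF/leq_maxr.
  by move: v Gk; exact/subsetPset/ndG/leq_maxl.
move=> i; have [mF Fi] := Foo i; have [mG Gi] := Goo i; split.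
  rewrite -[X in measurable X]setTI; apply: measurable_uncons_rV => //.
  exact: measurableX.
rewrite /lebesgueRd_step -comp_preimage (_ : _ \o _ = id); last first.
  by apply/funext => z /=; rewrite cons_rVK.
by rewrite preimage_id product_measure1E// lte_mul_pinfty// ge0_fin_numE.
Qed.

HB.instance Definition _ := Measure_isSigmaFinite.Build _ _ _ lebesgueRd_step
  step_sigma_finite.

End lebesgueRd_step.

Fixpoint lebesgueRd (R : realType) (n : nat) :
    {sigma_finite_measure set (borelRd R n) -> \bar R} :=
  match n return {sigma_finite_measure set (borelRd R n) -> \bar R} with
  | 0 => @dirac _ (borelRd R 0) (0 : 'rV[R]_0) R
  | n'.+1 => lebesgueRd_step (lebesgueRd R n')
  end.

Definition dotv (R : realType) (d : nat) (u v : 'rV[R]_d) : R :=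
  \sum_(i < d) u 0 i * v 0 i.

(* The library norm `|v| of a row vector is the sup norm. *)
Definition enorm (R : realType) (d : nat) (v : 'rV[R]_d) : R :=
  Num.sqrt (dotv v v).

Definition ebase (R : realType) (d : nat) (i : 'I_d) : 'rV[R]_d :=
  delta_mx 0 i.

Definition grad (R : realType) (d : nat) (f : 'rV[R]_d -> R) (x : 'rV[R]_d) :
  'rV[R]_d := \row_i 'D_(ebase R i) f x.

(* hessian f x i j = d_i (d_j f) (x) *)
Definition hessian (R : realType) (d : nat) (f : 'rV[R]_d -> R)
    (x : 'rV[R]_d) : 'M[R]_d :=
  \matrix_(i, j) 'D_(ebase R i) (fun z => 'D_(ebase R j) f z) x.

Definition hessian_form (R : realType) (d : nat) (f : 'rV[R]_d -> R)
  (x y : 'rV[R]_d) : R := dotv (y *m hessian f x) y.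

(* 'D_v f is a limit that takes a default value when it does not exist, so
   the existence of second derivatives is a separate property. *)
Definition twice_differentiable (R : realType) (d : nat)
    (f : 'rV[R]_d -> R) : Prop :=
  (forall x, differentiable f x) /\
  (forall (i : 'I_d) x, differentiable (fun z => 'D_(ebase R i) f z) x).

Fixpoint of_class (R : realType) (V : normedModType R) (k : nat)
    (f : V -> R) : Prop :=
  match k with
  | 0 => continuous f
  | k'.+1 => (forall x, differentiable f x) /\
             (forall v, of_class k' (fun z => 'D_v f z))
  end.

(* iterated partial derivative along the list of coordinates s *)
Definition partials (R : realType) (d : nat) (s : seq 'I_d)
    (f : 'rV[R]_d -> R) : 'rV[R]_d -> R :=
  foldr (fun i g => fun z => 'D_(ebase R i) g z) f s.

Record P1 (R : realType) (d : nat) := MkP1 {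
  P1_prob :> probability (borelRd R d) R ;
  P1_moment : (\int[P1_prob]_x (enorm (x : 'rV[R]_d))%:E < +oo)%E }.

Definition coupling (R : realType) (d : nat)
    (m1 m2 : probability (borelRd R d) R) :
    set (probability (borelRd R d * borelRd R d)%type R) :=
  [set g | (forall A, measurable A -> g (A `*` setT) = m1 A) /\
           (forall A, measurable A -> g (setT `*` A) = m2 A)].

Definition W1 (R : realType) (d : nat) (m1 m2 : P1 R d) : \bar R :=
  ereal_inf [set (\int[g]_z (enorm ((z.1 : 'rV[R]_d) - z.2))%:E)%E
            | g in coupling m1 m2].

(* mu : R -> P1 R d represents an element of C([0, T]; P_1); its values
   outside [0, T] are irrelevant. *)
Definition continuous_flow (R : realType) (d : nat) (T : R)
    (mu : R -> P1 R d) : Prop :=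
  forall s, 0 <= s <= T -> forall e, 0 < e -> exists2 dl, 0 < dl &
  forall t, 0 <= t <= T -> `|t - s| < dl -> (W1 (mu t) (mu s) < e%:E)%E.

Definition continuous_cost (R : realType) (d : nat)
    (h : 'rV[R]_d -> P1 R d -> R) : Prop :=
  forall x nu e, 0 < e -> exists2 dl, 0 < dl &
  forall y nu', enorm (y - x) < dl -> (W1 nu' nu < dl%:E)%E ->
    `|h y nu' - h x nu| < e.

Definition lagrangian_hyp (R : realType) (d : nat)
    (L : 'rV[R]_d -> 'rV[R]_d -> R) : Prop :=
  [/\ of_class 2 (fun z : 'rV[R]_d * 'rV[R]_d => L z.1 z.2),
      exists m, forall x a, m <= L x a &
      exists C1 C2 C3 C4 C5 : R,
      [/\ [/\ 0 < C1, 0 < C2, 0 < C3, 0 < C4 & 0 < C5],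
          forall x a, L x a <= C1 * enorm a ^+ 2 + C2,
          forall x a, enorm (grad (L ^~ a) x) <= C3 * (1 + enorm a ^+ 2),
          forall x a b, C4 * enorm b ^+ 2 <= hessian_form (L x) a b &
          forall x a y, hessian_form (L ^~ a) x y
                        <= C5 * (1 + enorm a ^+ 2) * enorm y ^+ 2]].

Definition hamiltonian (R : realType) (d : nat)
    (L : 'rV[R]_d -> 'rV[R]_d -> R) (x p : 'rV[R]_d) : R :=
  sup [set dotv a p - L x a | a in [set: 'rV[R]_d]].

Definition cost_hyp (R : realType) (d : nat)
    (h : 'rV[R]_d -> P1 R d -> R) : Prop :=
  continuous_cost h /\
  exists C1 C2 C3 : R,
  [/\ [/\ 0 < C1, 0 < C2 & 0 < C3],
      forall x nu, `|h x nu| <= C1,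
      forall x y nu, `|h x nu - h y nu| <= C2 * enorm (x - y) &
      forall x y nu, h (x + y) nu - 2 * h x nu + h (x - y) nu
                     <= C3 * enorm y ^+ 2].

Section control_problem.
Context (R : realType) (d : nat) (T : R).
Context (L : 'rV[R]_d -> 'rV[R]_d -> R) (F G : 'rV[R]_d -> P1 R d -> R).

Definition L2_control (t : R) (alpha : R -> 'rV[R]_d) : Prop :=
  measurable_fun `[t, T] (alpha : R -> borelRd R d) /\
  (\int[lebesgue_measure]_(s in `[t, T]) (enorm (alpha s) ^+ 2)%:E < +oo)%E.

Definition trajectory (t : R) (x : 'rV[R]_d) (alpha : R -> 'rV[R]_d) (s : R) :
    'rV[R]_d :=
  x - \row_i (\int[lebesgue_measure]_(r in `[t, s]) (alpha r 0 i)).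

Definition cost_functional (mu : R -> P1 R d) (t : R) (x : 'rV[R]_d)
    (alpha : R -> 'rV[R]_d) : R :=
  \int[lebesgue_measure]_(s in `[t, T])
     (L (trajectory t x alpha s) (alpha s) + F (trajectory t x alpha s) (mu s))
  + G (trajectory t x alpha T) (mu T).

Definition control_bound (Cb : R) : Prop :=
  forall mu, continuous_flow T mu -> forall t x, 0 <= t <= T ->
  exists alpha,
  [/\ L2_control t alpha,
      {ae lebesgue_measure, forall s, t <= s <= T -> enorm (alpha s) <= Cb} &
      forall alpha', L2_control t alpha' ->
        cost_functional mu t x alpha <= cost_functional mu t x alpha'].

End control_problem.

Section scheme.
Context (R : realType) (d : nat).

Definition grid_point (dx : R) (i : 'rV[int]_d) : 'rV[R]_d :=
  dx *: map_mx intr i.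

Definition beta1 (dx : R) (i : 'rV[int]_d) (z : 'rV[R]_d) : R :=
  \prod_(l < d) Num.max 0 (1 - `|z 0 l / dx - (i 0 l)%:~R|).

(* For each x only finitely many i have beta1 dx i x != 0, so this finitely
   supported sum is the sum over Z^d. *)
Definition interp1 (dx : R) (phi : 'rV[int]_d -> R) (x : 'rV[R]_d) : R :=
  \sum_(i \in [set: 'rV[int]_d]) phi i * beta1 dx i x.

Context (T : R) (L : 'rV[R]_d -> 'rV[R]_d -> R).
Context (F G : 'rV[R]_d -> P1 R d -> R) (Cb : R) (mu : R -> P1 R d).
Context (N : nat) (dt dx : R).

(* v_remaining n = v_{N - n}: n counts the steps left before the final time. *)
Fixpoint v_remaining (n : nat) : 'rV[int]_d -> R :=
  match n with
  | 0 => fun i => G (grid_point dx i) (mu T)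
  | n'.+1 => fun i =>
      inf [set dt * L (grid_point dx i) a
               + interp1 dx (v_remaining n') (grid_point dx i - dt *: a)
          | a in [set a | enorm a <= Cb]]
      + dt * F (grid_point dx i) (mu ((N - n'.+1)%N%:R * dt))
  end.

Definition v_grid (k : nat) : 'rV[int]_d -> R := v_remaining (N - k).

(* For t in [0, T], Num.truncn (t / dt) is the k with t_k <= t < t_(k+1),
   and it is N at t = T = N dt. *)
Definition v_interp (t : R) (x : 'rV[R]_d) : R :=
  interp1 dx (v_grid (Num.truncn (t / dt))) x.

Definition rescale (rho : 'rV[R]_d -> R) (eps : R) (x : 'rV[R]_d) : R :=
  (eps ^+ d)^-1 * rho (eps^-1 *: x).

Definition v_mollified (rho : 'rV[R]_d -> R) (eps : R) (t : R)
    (x : 'rV[R]_d) : R :=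
  \int[lebesgueRd R d]_z (rescale rho eps (x - (z : 'rV[R]_d)) * v_interp t z).

End scheme.

(* "Bounded derivatives of any order" is taken in the sup norm and in L^1:
   with sup bounds alone, rho_eps * v need not be twice differentiable, and
   second derivatives that exist are not controlled by Lipschitz bounds on v. *)
Definition mollifier (R : realType) (d : nat) (rho : 'rV[R]_d -> R) : Prop :=
  [/\ forall k, of_class k rho,
      forall s, exists M, forall x, `|partials s rho x| <= M,
      forall s, (lebesgueRd R d).-integrable setT (EFin \o partials s rho),
      forall x, 0 <= rho x &
      (\int[lebesgueRd R d]_x (rho x)%:E = 1)%E].

(* Main.v *)
Require Import Defs.
From HB Require Import structures.
From mathcomp Require Import all_boot all_order all_algebra.
From mathcomp Require Import all_classical all_reals all_analysis.
From mathcomp Require Import measurable_realfun ring lra zify.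
Import Order.TTheory GRing.Theory Num.Theory.
Import numFieldTopology.Exports numFieldNormedType.Exports.
Local Open Scope classical_set_scope.
Local Open Scope ring_scope.

(** Interpolation on the grid commutes with translations by grid vectors.
    Hence three properties of the grid values pass through one backward step
    of the scheme, each constant growing by a multiple of dt: a sup bound, a
    Lipschitz bound K for unit grid steps, and the discrete semiconcavity
    v (i + j) - 2 v i + v (i - j) <= C |x_j|^2.  For the last one, a single
    control a is used at the three points: an infimum at an outer point is at
    most the value of a there, and a is then optimised at the middle point
    only (infimum_second_difference).  As n dt <= T, the constants K and C
    depend on the data, T and Cb only; the sup bound makes the convolutions
    below meaningful (v_remaining_bounded, v_remaining_lipschitz,
    v_remaining_semiconcave).

    The interpolant w need not be semiconcave: w (x + z) - 2 w x + w (x - z) is at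
    most C |z|^2 for all x, but only for grid vectors z.  The mollification
    has to repair the other directions.  Write rho_eps * w as x |-> f (x / eps)
    with f = rho * W and W u = w (eps u); the grid of W has step
    delta = dx / eps, its Lipschitz constant is eps K and its semiconcavity
    constant is eps^2 C.  Every derivative of f of order n + 1 is at most eps K
    times the L^1 norm of a derivative of rho of order n, because one
    derivative can be moved to the Lipschitz factor W.

    Fix y.  The corners z_b of the cell of y have weights beta_b, of sum 1,
    with mean y.  Averaging f (x + z_b) - 2 f x + f (x - z_b) <= eps^2 C |z_b|^2
    with these weights, and replacing z_b by y, gives a bound for the second
    difference of f along y: the first order terms cancel since the mean is y,
    so the replacement costs delta^2 sup |D^2 f| only.  A symmetric Taylor
    expansion of order four then gives

      D^2 f (y, y) <= eps^2 C (2 |y|^2 + 2 d delta^2)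
                      + O (eps K delta^2) + O (eps K |y|^4).

    (hessian_le_average).  Dividing by |y|^2, and by eps^2 to return to the
    original scale, turns the last two terms into O (K) dx^2 / (eps^3 |y|^2) and
    O (K) |y|^2 / eps.  A small y costs in the former and a large y in the
    latter; for |y|^2 = eps the sum is

      2 C (1 + d dx^2 / eps^3) + O (K) (1 + dx^2 / eps^4),

    which is the claim since eps < 1.

    The convolution is differentiated by an estimate in L^1, not by dominated
    convergence: the derivatives of rho are integrable, but their suprema over
    small balls need not be.  By Tonelli, the L^1 norm of the first order
    Taylor remainder of g along v is at most that of the second derivative of
    g along v (L1_taylor1), so g * W has a quadratic first order remainder at
    every point (conv_differentiable). *)

Set Implicit Arguments.
Unset Strict Implicit.
Unset Printing Implicit Defensive.

(** * The Euclidean norm and the Hessian form *)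

Definition l1norm (R : realType) (d : nat) (y : 'rV[R]_d) : R :=
  \sum_i `|y 0 i|.

Lemma enorm_sqr (R : realType) (d : nat) (y : 'rV[R]_d) :
  enorm y ^+ 2 = \sum_i y 0 i ^+ 2.
Proof.
rewrite /enorm sqr_sqrtr; first by apply: eq_bigr => i _; rewrite expr2.
by apply: sumr_ge0 => i _; rewrite -expr2 sqr_ge0.
Qed.

Lemma enorm_ge0 (R : realType) (d : nat) (y : 'rV[R]_d) : 0 <= enorm y.
Proof. exact: sqrtr_ge0. Qed.

Lemma enormZ (R : realType) (d : nat) (c : R) (y : 'rV[R]_d) :
  enorm (c *: y) = `|c| * enorm y.
Proof.
apply/eqP; rewrite -(@eqrXn2 _ 2)// ?enorm_ge0 ?mulr_ge0 ?enorm_ge0//.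
rewrite exprMn !enorm_sqr real_normK ?num_real// mulr_sumr.
by apply/eqP; apply: eq_bigr => i _; rewrite mxE exprMn.
Qed.

(** This is the Cauchy-Schwarz inequality; each product of two coordinates is
    at most the half sum of their squares. *)
Lemma l1norm_sqr (R : realType) (d : nat) (y : 'rV[R]_d) :
  l1norm y ^+ 2 <= d%:R * enorm y ^+ 2.
Proof.
rewrite enorm_sqr expr2 /l1norm mulr_suml.
under eq_bigr do rewrite mulr_sumr.
apply: (@le_trans _ _ (\sum_(i < d) \sum_(j < d) (y 0 i ^+ 2 + y 0 j ^+ 2) / 2)).
  apply: ler_sum => i _; apply: ler_sum => j _.
  rewrite ler_pdivlMr// -(real_normK (num_real (y 0 i))).
  rewrite -(real_normK (num_real (y 0 j))) -subr_ge0.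
  by rewrite (_ : _ - _ = (`|y 0 i| - `|y 0 j|) ^+ 2) ?sqr_ge0//; ring.
under eq_bigr => i _.
  rewrite -mulr_suml big_split/= sumr_const card_ord.
  over.
rewrite -mulr_suml big_split/= sumr_const card_ord sumrMnl mulr_natl.
by rewrite -mulr2n -[_ *+ 2]mulr_natr mulfK.
Qed.

Lemma abs_coord_le_enorm (R : realType) (d : nat) (v : 'rV[R]_d) i :
  `|v 0 i| <= enorm v.
Proof.
rewrite -ler_sqr ?nnegrE ?enorm_ge0// enorm_sqr real_normK ?num_real//.
by rewrite (bigD1 i)//= lerDl sumr_ge0// => j _; exact: sqr_ge0.
Qed.

Lemma enorm_ebase (R : realType) (d : nat) (l : 'I_d) : enorm (ebase R l) = 1.
Proof.
apply/eqP; rewrite -(@eqrXn2 _ 2)// ?enorm_ge0// enorm_sqr expr1n.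
rewrite (bigD1 l)//= mxE !eqxx expr1n big1 ?addr0// => k kl.
by rewrite mxE (negbTE kl) andbF expr0n.
Qed.

Lemma enorm_eq0 (R : realType) (d : nat) (y : 'rV[R]_d) : enorm y = 0 -> y = 0.
Proof.
move=> y0; apply/rowP => i; rewrite mxE; apply/eqP; rewrite -normr_le0.
by rewrite -y0; exact: abs_coord_le_enorm.
Qed.

Lemma hessian_formE (R : realType) (d : nat) (f : 'rV[R]_d -> R)
    (x y : 'rV[R]_d) : hessian_form f x y =
  \sum_j (\sum_i y 0 i * 'D_(ebase R i) (fun z => 'D_(ebase R j) f z) x) * y 0 j.
Proof.
by apply: eq_bigr => j _; congr (_ * _); rewrite mxE; apply: eq_bigr => i _;
   rewrite mxE.
Qed.

Lemma hessian_formZ (R : realType) (d : nat) (f : 'rV[R]_d -> R)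
    (x y : 'rV[R]_d) (c : R) :
  hessian_form f x (c *: y) = c ^+ 2 * hessian_form f x y.
Proof.
rewrite !hessian_formE mulr_sumr; apply: eq_bigr => j _.
rewrite mxE expr2 mulrACA mulr_sumr; congr (_ * _); apply: eq_bigr => i _.
by rewrite mxE mulrA.
Qed.

(** * Lebesgue measure under affine maps *)

Lemma measurable_continuous (R : realType) (n : nat) (f : 'rV[R]_n -> R) :
  continuous f -> measurable_fun [set: borelRd R n] (f : borelRd R n -> R).
Proof.
move=> cf; apply: (measurability _ (RGenOpens.measurableE R)) => //.
move=> _ [_ [a [b ->]] <-]; rewrite setTI; apply: sub_sigma_algebra.
by apply: open_comp => [? _|]; [exact: cf|exact: interval_open].
Qed.

Lemma measurable_continuous_rV (R : realType) (n : nat)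
    (phi : 'rV[R]_n -> 'rV[R]_n) :
  continuous phi ->
  measurable_fun [set: borelRd R n] (phi : borelRd R n -> borelRd R n).
Proof.
move=> cphi; apply: (@measurability _ _ _ (borelRd R n) setT _
  [set A : set 'rV[R]_n | open A] erefl).
move=> _ [U oU <-]; rewrite setTI; apply: sub_sigma_algebra.
by apply: open_comp => // ? _; exact: cphi.
Qed.

Lemma affine_continuous (R : realType) (V : normedModType R) (c : V) (b : R) :
  continuous (fun z : V => c + b *: z).
Proof.
move=> z; apply: cvgD; first exact: cvg_cst.
by apply: cvgZr; exact: cvg_id.
Qed.

(** Both sides are measures in A, so it is enough to compare them on half-open
    intervals. *)
Lemma lebesgue_measure_affine (R : realType) (b c : R) (A : set R) : b != 0 ->
  measurable A ->
  (@lebesgue_measure R ((fun r : R => c + b * r)%R @^-1` A) =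
   (`|b|^-1)%:E * lebesgue_measure A)%E.
Proof.
move=> b0 mA.
have mphi : measurable_fun [set: measurableTypeR R]
    (fun r => c + b * r : measurableTypeR R).
  by apply: continuous_measurable_fun => x; exact: (@affine_continuous R R^o).
have nb0 : 0 < `|b| by rewrite normr_gt0.
have H : lebesgue_measure A = mscale (NngNum (ltW nb0))
   (pushforward lebesgue_measure (fun r => c + b * r : measurableTypeR R)) A.
  move=> m'; apply: lebesgue_measure_unique => // _ [[u v]] _ <-.
  rewrite -[RHS]/(`|b|%:E * lebesgue_measure ((fun r : R => c + b * r)%R @^-1`
    `]u, v]%classic))%E.
  have [bn|bp|b_eq0] := ltgtP b 0; last by rewrite b_eq0 eqxx in b0.
  - rewrite (_ : _ @^-1` _ = `[((v - c) / b), ((u - c) / b)[%classic).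
      rewrite !lebesgue_measure_itv/= !lte_fin ltr_nM2r ?invr_lt0// ltrD2r.
      case: ifP => _; last by rewrite mule0.
      rewrite -!EFinD -EFinM ltr0_norm//; congr (_%:E); field; exact: ltr0_neq0.
    apply/seteqP; split => r /=; rewrite !in_itv/= ltr_ndivlMr// ler_ndivrMr//
      => /andP[]; rewrite ltrBlDl lerBrDl (mulrC r) => -> ->//.
  - rewrite (_ : _ @^-1` _ = `]((u - c) / b), ((v - c) / b)]%classic).
      rewrite !lebesgue_measure_itv/= !lte_fin ltr_pM2r ?invr_gt0// ltrD2r.
      case: ifP => _; last by rewrite mule0.
      rewrite -!EFinD -EFinM gtr0_norm//; congr (_%:E); field; exact: lt0r_neq0.
    apply/seteqP; split => r /=; rewrite !in_itv/= ltr_pdivrMr// ler_pdivlMr//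
      => /andP[]; rewrite ltrBlDl lerBrDl (mulrC r) => -> ->//.
rewrite (H mphi) -[X in (_ * X)%E]/(`|b|%:E * lebesgue_measure
  ((fun r : R => c + b * r)%R @^-1` A))%E muleA -EFinM mulVf ?mul1e//.
exact: lt0r_neq0.
Qed.

Lemma ge0_integral_affine (R : realType) (b c : R) (f : R -> \bar R) : b != 0 ->
  measurable_fun [set: measurableTypeR R] f -> (forall r, 0 <= f r)%E ->
  (\int[lebesgue_measure]_r f (c + b * r)%R =
   (`|b|^-1)%:E * \int[lebesgue_measure]_r f r)%E.
Proof.
move=> b0 mf f0.
have mphi : measurable_fun [set: measurableTypeR R]
    (fun r => c + b * r : measurableTypeR R).
  by apply: continuous_measurable_fun => x; exact: (@affine_continuous R R^o).
have b1 : 0 <= `|b|^-1 by rewrite invr_ge0.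
rewrite -(ge0_integral_mscale _ measurableT (NngNum b1) mf)//.
rewrite -[LHS](ge0_integral_pushforward mphi lebesgue_measure measurableT mf)//.
apply: eq_measure_integral => A mA _.
exact: lebesgue_measure_affine.
Qed.

(** Tonelli for the product that defines the measure in dimension n + 1. *)
Lemma ge0_integral_lebesgueRdS (R : realType) (n : nat)
    (f : borelRd R n.+1 -> \bar R) :
  measurable_fun setT f -> (forall z, 0 <= f z)%E ->
  (\int[lebesgueRd R n.+1]_z f z =
   \int[lebesgue_measure]_r \int[lebesgueRd R n]_v f (cons_rV (r, v)))%E.
Proof.
move=> mf f0.
rewrite -[RHS](@fubini_tonelli1 _ _ _ _ R lebesgue_measure (lebesgueRd R n)
  (f \o @cons_rV R n)).
- by rewrite -[RHS](ge0_integral_pushforward (@measurable_cons_rV R n)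
    (lebesgue_measure \x lebesgueRd R n)%E measurableT mf).
- by apply: measurableT_comp => //; exact: measurable_cons_rV.
- by move=> z; exact: f0.
Qed.

Lemma cons_rV_affine (R : realType) (n : nat) (c : 'rV[R]_n.+1) (b r : R)
    (v : 'rV[R]_n) :
  c + b *: (cons_rV (r, v) : 'rV[R]_n.+1) =
  cons_rV (c 0 0 + b * r, rsubmx (c : 'rV_(1 + n)) + b *: v).
Proof.
rewrite -[in LHS](@uncons_rVK R n c) /cons_rV /uncons_rV/=.
transitivity ((row_mx (c 0 0)%:M (rsubmx (c : 'rV_(1 + n))) : 'rV[R]_(1 + n)) +
   b *: (row_mx r%:M v : 'rV[R]_(1 + n))) => //.
rewrite scale_row_mx add_row_mx; congr (@row_mx _ 1 1 n _ _).
by apply/matrixP => i j; rewrite !mxE !ord1 !mulr1n.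
Qed.

(** By induction on the dimension, one coordinate at a time: an affine map
    with scalar linear part respects the splitting of a vector into its head
    and its tail. *)
Lemma ge0_integral_lebesgueRd_affine (R : realType) (n : nat)
    (c : 'rV[R]_n) (b : R)
    (f : borelRd R n -> \bar R) : b != 0 ->
  measurable_fun setT f -> (forall z, 0 <= f z)%E ->
  (\int[lebesgueRd R n]_z f ((c + b *: (z : 'rV[R]_n))%R : borelRd R n) =
   ((`|b| ^- n)%R)%:E * \int[lebesgueRd R n]_z f z)%E.
Proof.
move=> b0; elim: n => [|n ih] in c f * => mf f0.
  rewrite expr0 invr1 mul1e; apply: eq_integral => z _.
  congr f.
  by rewrite (thinmx0 (c + b *: (z : 'rV[R]_0))) -(thinmx0 (z : 'rV[R]_0)).
rewrite !ge0_integral_lebesgueRdS//; last first.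
  exact: (measurableT_comp mf (measurable_continuous_rV
    (@affine_continuous R 'rV[R]_n.+1 c b))).
under eq_integral => r _.
  under eq_integral do rewrite cons_rV_affine.
  rewrite (ih _ (fun v => f (cons_rV (c 0 0 + b * r, v))))//; last first.
    exact: (measurableT_comp mf (measurableT_comp (@measurable_cons_rV R n)
      (measurable_pair1 _))).
  over.
pose F r := (\int[lebesgueRd R n]_v f (cons_rV (r, v)))%E.
have mF : measurable_fun [set: measurableTypeR R] F.
  apply: (@measurable_fun_fubini_tonelli_F _ _ _ _ R (lebesgueRd R n)
    (f \o @cons_rV R n)) => //.
  + exact: (measurableT_comp mf (@measurable_cons_rV R n)).
  + by move=> z; exact: f0.
have F0 r : (0 <= F r)%E by exact: integral_ge0.
transitivity (\int[lebesgue_measure]_r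
    (((`|b| ^- n)%R)%:E * (fun r => F (c 0 0 + b * r)%R) r))%E => //.
transitivity (((`|b| ^- n.+1)%R)%:E * \int[lebesgue_measure]_r F r)%E => //.
clearbody F; have mG : measurable_fun [set: measurableTypeR R]
    (fun r : measurableTypeR R => F (c 0 0 + b * r)).
  apply: (measurableT_comp mF) => //=.
  by apply: continuous_measurable_fun => x; exact: (@affine_continuous R R^o).
rewrite (ge0_integralZl lebesgue_measure measurableT mG).
- rewrite (ge0_integral_affine (c 0 0) b0 mF)// muleA -EFinM.
  by rewrite exprSr invfM mulrC.
- by move=> r _; exact: F0.
- by rewrite lee_fin invr_ge0 exprn_ge0.
Qed.

Section affine_change.
Context (R : realType) (n : nat).
Local Notation mu := (lebesgueRd R n).
Implicit Types (f : 'rV[R]_n -> R).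

Lemma measurable_affine f (c : 'rV[R]_n) (b : R) :
  measurable_fun [set: borelRd R n] (f : borelRd R n -> R) ->
  measurable_fun [set: borelRd R n]
    ((fun z : 'rV[R]_n => f (c + b *: z)) : borelRd R n -> R).
Proof.
move=> mf; exact: (measurableT_comp mf (measurable_continuous_rV
  (@affine_continuous R 'rV[R]_n c b))).
Qed.

(** Integrability of f is what makes the difference of the integrals of the
    positive and negative parts meaningful, hence compatible with scaling. *)
Lemma integral_lebesgueRd_affine f (c : 'rV[R]_n) (b : R) : b != 0 ->
  mu.-integrable setT (EFin \o f) ->
  (\int[mu]_z ((f (c + b *: (z : 'rV[R]_n)))%:E) =
   ((`|b| ^- n)%R)%:E * \int[mu]_z (f z)%:E)%E.
Proof.
move=> b0 intf.
have mf := measurable_int _ intf.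
rewrite integralE [in RHS]integralE.
rewrite muleBr//; last first.
  apply: fin_num_adde_defl; rewrite fin_numN.
  exact: (integrable_neg_fin_num measurableT intf).
rewrite -!(ge0_integral_lebesgueRd_affine c b0)//.
- by congr (_ - _)%E; apply: eq_integral => z _; rewrite ?funeposE ?funenegE.
- exact: measurable_funeneg.
- exact: measurable_funepos.
Qed.

Lemma integrable_lebesgueRd_affine f (c : 'rV[R]_n) (b : R) : b != 0 ->
  mu.-integrable setT (EFin \o f) ->
  mu.-integrable setT (EFin \o (fun z : borelRd R n => f (c + b *: (z : 'rV[R]_n)))).
Proof.
move=> b0 intf; have mf := measurable_int _ intf.
have mabs : measurable_fun setT (fun z : borelRd R n => `|(f z)%:E|%E).
  exact: measurableT_comp.
apply/integrableP; split.
  exact: (measurableT_comp mf (measurable_continuous_rV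
    (@affine_continuous R 'rV[R]_n c b))).
rewrite (@ge0_integral_lebesgueRd_affine R n c b (fun z => `|(f z)%:E|%E))//.
by rewrite lte_mul_pinfty//; case/integrableP : intf.
Qed.

Lemma Rintegral_lebesgueRd_affine f (c : 'rV[R]_n) (b : R) : b != 0 ->
  mu.-integrable setT (EFin \o f) ->
  \int[mu]_z f (c + b *: (z : 'rV[R]_n)) = `|b| ^- n * \int[mu]_z f z.
Proof.
move=> b0 intf; rewrite /Rintegral integral_lebesgueRd_affine// fineM//.
exact: (integrable_fin_num measurableT intf).
Qed.
End affine_change.

(** * Calculus along lines *)

Lemma is_derive_line (R : realType) (V : normedModType R) (f : V -> R)
    (x v : V) (t a : R) :
  is_derive (x + t *: v) v f a -> is_derive t 1 (fun s : R => f (x + s *: v)) a.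
Proof.
pose E (h : R) := h^-1 *: ((f \o shift (x + t *: v)) (h *: v) - f (x + t *: v)).
have -> : is_derive t 1 (fun s : R => f (x + s *: v)) a =
    is_derive (x + t *: v) v f a; last by [].
rewrite propeqE; split => -[h1 h2]; split; move: h1 h2;
  rewrite /derivable /derive /=;
  rewrite (_ : (fun h : R => h^-1 *: (f (x + (h *: 1 + t) *: v) - f (x + t *: v)))
    = E)//; apply/funext => h; rewrite /E /=;
  by rewrite scalerDl /GRing.scale/= mulr1 addrCA.
Qed.

Lemma differentiable_is_derive (R : realType) (V : normedModType R) (f : V -> R)
    (x v : V) : differentiable f x -> is_derive x v f ('D_v f x).
Proof. by move=> df; apply: derivableP; exact: diff_derivable. Qed.

(** A remainder that is quadratic in h is o(h), so l is the differential. *)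
Lemma quadratic_remainder_diff (R : realType) (V : normedModType R) (f : V -> R)
    (x : V) (l : V -> R) (c : R) :
  linear l -> continuous l ->
  (forall h, `|f (x + h) - f x - l h| <= c * `|h| ^+ 2) ->
  differentiable f x /\ forall v, 'D_v f x = l v.
Proof.
move=> lin_l cl fl.
pose lM := GRing.isLinear.Build _ _ _ _ _ lin_l.
pose L : {linear V -> R} := HB.pack l lM.
have fo : f \o shift x = cst (f x) + L +o_ 0 id.
  apply/eqaddoP => e e0.
  have c1 : 0 < `|c| + 1 by rewrite ltr_wpDl.
  have ec : 0 < e / (`|c| + 1) by rewrite divr_gt0.
  near=> h.
  rewrite (_ : (_ - _) h = f (x + h) - f x - l h); last first.
    by rewrite !fctE/= opprD addrA (addrC h).
  rewrite (le_trans (fl h))// expr2 mulrA ler_wpM2r//.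
  have hh : `|h| <= e / (`|c| + 1).
    by near: h; apply: nbhs0_le.
  rewrite (@le_trans _ _ ((`|c| + 1) * `|h|))//.
    by rewrite ler_wpM2r// (le_trans (ler_norm _))// lerDl.
  by rewrite mulrC -ler_pdivlMr.
have df := diff_unique (df := L) cl fo.
have dfx : differentiable f x.
  by apply/diff_locallyP; rewrite df.
by split=> // v; rewrite deriveE// df.
Unshelve. all: by end_near. Qed.

Lemma norm_coord (R : realType) (d : nat) (v : 'rV[R]_d) (i : 'I_d) :
  `|v 0 i| <= `|v|.
Proof.
rewrite -[leRHS]/(mx_norm v) mx_normrE.
exact: (le_bigmax _ (fun ij : 'I_1 * 'I_d => `|v ij.1 ij.2|) (0, i)).
Qed.

Lemma rV_sum_ebase (R : realType) (d : nat) (v : 'rV[R]_d) :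
  v = \sum_i v 0 i *: ebase R i.
Proof. exact: row_sum_delta. Qed.

Lemma derive_partials (R : realType) (d : nat) (f : 'rV[R]_d -> R)
    (x v : 'rV[R]_d) :
  differentiable f x -> 'D_v f x = \sum_i v 0 i * 'D_(ebase R i) f x.
Proof.
move=> df; rewrite deriveE// {1}(rV_sum_ebase v) linear_sum.
by apply: eq_bigr => i _; rewrite linearZ deriveE.
Qed.

(** The mean value theorem gives p 1 - p 0 = p1 c, and p1 c - p1 0 is the
    integral of p2 over a part of the unit interval. *)
Lemma taylor1_integral_remainder (R : realType) (p p1 p2 : R -> R) :
  (forall t : R, is_derive t (1 : R) p (p1 t)) ->
  (forall t : R, is_derive t (1 : R) p1 (p2 t)) -> continuous p2 ->
  (`|p 1 - p 0 - p1 0|%:E <=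
   \int[lebesgue_measure]_(t in `[0%R, 1%R]) `|p2 t|%:E)%E.
Proof.
move=> dp dp1 cp2.
have cp : {within `[0, 1], continuous p}.
  by apply: derivable_within_continuous => t _.
have cp1 t : {for t, continuous p1}.
  by apply: differentiable_continuous; apply/derivable1_diffP.
have [c] := MVT ltr01 (fun t _ => dp t) cp.
rewrite in_itv/= => /andP[c0 c1]; rewrite subr0 mulr1 => ->.
have := @continuous_FTC2 R p2 p1 0 c c0.
rewrite -[X in (X <= _)%E]/(`|(p1 c - p1 0)%:E|%E) -EFinB => <-.
- apply: (@le_trans _ _ (\int[lebesgue_measure]_(t in `[0%R, c]) `|p2 t|%:E)%E).
    apply: (le_trans (le_abse_integral _ _ _)) => //.
    apply/measurable_EFinP; apply: measurable_funTS.
    exact: continuous_measurable_fun.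
  apply: ge0_subset_integral => //.
    apply/measurable_EFinP; apply: measurable_funTS.
    apply: measurableT_comp => //; exact: continuous_measurable_fun.
  by apply: subset_itvl; rewrite bnd_simp ltW.
- exact: continuous_subspaceT.
- split; [by move=> t _|apply: cvg_at_right_filter; exact: cp1|
    apply: cvg_at_left_filter; exact: cp1].
- by move=> t _; rewrite derive1E; exact: derive_val.
Qed.

Lemma translation_continuous (R : realType) (V : normedModType R) (c : V) :
  continuous (fun z : V => z + c).
Proof. by move=> z; apply: cvgD; [exact: cvg_id|exact: cvg_cst]. Qed.

Lemma line_continuous (R : realType) (V : normedModType R) (x v : V) :
  continuous (fun t : R => x + t *: v).
Proof.
by move=> t; apply: cvgD; [exact: cvg_cst|apply: cvgZl; exact: cvg_id].
Qed.

(** Points of the line x + t v are encoded by the single vector (t, x), so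
    that measurability in (t, x) jointly follows from continuity on row
    vectors. *)
Lemma line_shift_continuous (R : realType) (d : nat) (v : 'rV[R]_d) :
  continuous (fun w : 'rV[R]_(1 + d) => rsubmx w + w 0 0 *: v).
Proof.
have gen (V W : normedModType R) (A : V -> W) (l : V -> R) (b : W) :
    continuous A -> continuous l -> continuous (fun w => A w + l w *: b).
  by move=> cA cl w; apply: cvgD; [exact: cA|apply: cvgZl; exact: cl].
apply: (gen 'rV[R]_(1 + d) 'rV[R]_d).
- by move=> w; apply/differentiable_continuous; exact: differentiable_rsubmx.
- by move=> w; exact: coord_continuous.
Qed.

Lemma measurable_line_shift (R : realType) (d : nat) (g : 'rV[R]_d -> R)
    (v : 'rV[R]_d) : continuous g ->
  measurable_fun [set: measurableTypeR R * borelRd R d]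
    (fun z => g ((z.2 : 'rV[R]_d) + (z.1 : R) *: v)).
Proof.
move=> cg.
pose G (w : 'rV[R]_(1 + d)) := g (rsubmx w + w 0 0 *: v).
have cG : continuous G.
  by move=> w; apply: continuous_comp; [exact: line_shift_continuous|exact: cg].
have := measurableT_comp (@measurable_continuous R d.+1 G cG) (@measurable_cons_rV R d).
apply: eq_measurable_fun => -[t u] _ /=.
have := @cons_rVK R d (t, u); rewrite /uncons_rV => -[e1 e2].
by rewrite /G e1 e2.
Qed.

(** Pointwise, the remainder at u is at most the integral of |g2| over the
    segment from u to u + v.  Integrate in u, exchange the integrals by
    Tonelli, and use that the measure is invariant under u |-> u + t v. *)
Lemma L1_taylor1 (R : realType) (d : nat) (g g1 g2 : 'rV[R]_d -> R)
    (v : 'rV[R]_d) :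
  (forall x, is_derive x v g (g1 x)) -> (forall x, is_derive x v g1 (g2 x)) ->
  continuous g -> continuous g1 -> continuous g2 ->
  (\int[lebesgueRd R d]_u `|g ((u : 'rV[R]_d) + v) - g u - g1 u|%:E <=
   \int[lebesgueRd R d]_u `|g2 u|%:E)%E.
Proof.
move=> dg dg1 cg cg1 cg2.
pose H (z : measurableTypeR R * borelRd R d) : \bar R :=
  (\1_(`[0, 1]%classic : set R) z.1 * `|g2 ((z.2 : 'rV[R]_d) + (z.1 : R) *: v)|)%:E.
have mH : measurable_fun setT H.
  apply/measurable_EFinP; apply: measurable_funM.
    apply: measurableT_comp => //; exact: measurable_indic.
  by apply: measurableT_comp => //; exact: measurable_line_shift.
have H0 z : (0 <= H z)%E by rewrite lee_fin mulr_ge0.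
have mg (f : 'rV[R]_d -> R) : continuous f ->
   measurable_fun [set: borelRd R d] (f : borelRd R d -> R).
  exact: measurable_continuous.
have mgv : measurable_fun [set: borelRd R d]
    ((fun u : 'rV[R]_d => g (u + v)) : borelRd R d -> R).
  apply: mg => u; apply: continuous_comp; last exact: cg.
  exact: (@translation_continuous R 'rV[R]_d).
apply: (@le_trans _ _ (\int[lebesgueRd R d]_u \int[lebesgue_measure]_t H (t, u))%E).
  apply: ge0_le_integral => //.
  - apply/measurable_EFinP; apply: measurableT_comp => //.
    by apply: measurable_funB; [apply: measurable_funB => //; exact: mg|exact: mg].
  - exact: (@measurable_fun_fubini_tonelli_G _ _ _ _ R lebesgue_measure H mH H0).
  move=> u _.
  rewrite (_ : (\int[lebesgue_measure]_t H (t, u) =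
      \int[lebesgue_measure]_(t in `[0%R, 1%R]) `|g2 ((u : 'rV[R]_d) + t *: v)|%:E)%E).
    have := @taylor1_integral_remainder R (fun t : R => g ((u : 'rV[R]_d) + t *: v))
      (fun t : R => g1 ((u : 'rV[R]_d) + t *: v))
      (fun t : R => g2 ((u : 'rV[R]_d) + t *: v)).
    rewrite scale1r scale0r addr0; apply.
    + by move=> t; apply: is_derive_line; exact: dg.
    + by move=> t; apply: is_derive_line; exact: dg1.
    + move=> t; apply: continuous_comp; last exact: cg2.
      exact: (@line_continuous R 'rV[R]_d).
  rewrite [RHS]integral_mkcond; apply: eq_integral => t _.
  by rewrite /H patchE indicE; case: ifP => _; rewrite ?mul1r ?mul0r.
rewrite -(fubini_tonelli H mH H0).
set C : \bar R := (\int[lebesgueRd R d]_u `|g2 u|%:E)%E.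
rewrite (_ : (\int[lebesgue_measure]_t \int[lebesgueRd R d]_u H (t, u) =
    \int[lebesgue_measure]_(t in `[0%R, 1%R]) cst C t)%E).
  rewrite integral_cst//.
  by rewrite (_ : _ `[0%R, 1%R]%classic = 1%E) ?mule1//
    [LHS]lebesgue_measure_itv/= lte01 oppr0 adde0.
rewrite [RHS]integral_mkcond; apply: eq_integral => t _.
rewrite patchE; case: ifPn => ht.
  transitivity (\int[lebesgueRd R d]_u `|g2 (t *: v + 1 *: (u : 'rV[R]_d))|%:E)%E.
    apply: eq_integral => u _; rewrite /H indicE ht mul1r scale1r addrC//.
  rewrite (@ge0_integral_lebesgueRd_affine R d (t *: v) 1 (fun u => `|g2 u|%:E))//.
  - by rewrite normr1 expr1n invr1 mul1e.
  - by apply/measurable_EFinP; apply: measurableT_comp => //; exact: mg.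
by apply: integral0_eq => u _; rewrite /H indicE (negbTE ht) mul0r.
Qed.

(** * Convolution with bounded functions *)

Lemma continuous_lincomb (R : realType) (V : normedModType R) (I : Type)
    (s : seq I) (k : I -> R) (f : I -> V -> R) :
  (forall i, continuous (f i)) -> continuous (fun u => \sum_(i <- s) k i * f i u).
Proof.
move=> cf; elim: s => [|i s ih] u.
  rewrite (_ : (fun _ => _) = cst 0); first exact: cvg_cst.
  by apply/funext => w; rewrite big_nil.
rewrite (_ : (fun _ => _) =
  (fun w => k i * f i w + \sum_(j <- s) k j * f j w)); last first.
  by apply/funext => w; rewrite big_cons.
by apply: cvgD; [apply: cvgMr; exact: cf|exact: ih].
Qed.

Section convolution.
Context (R : realType) (d : nat).
Local Notation mu := (lebesgueRd R d).
Local Notation "'L1' f" := (mu.-integrable setT (EFin \o f)) (at level 10).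
Implicit Types (g r W : 'rV[R]_d -> R) (x v : 'rV[R]_d).

Definition conv g W x : R := \int[mu]_z (g (x - (z : 'rV[R]_d)) * W z).

Lemma L1B (f g : 'rV[R]_d -> R) : L1 f -> L1 g -> L1 (fun u => f u - g u).
Proof. by move=> hf hg; exact: (integrableB measurableT hf hg). Qed.

Lemma L1Z (k : R) (f : 'rV[R]_d -> R) : L1 f -> L1 (fun u => k * f u).
Proof. by move=> hf; exact: (integrableZl measurableT k hf). Qed.

Lemma L1_sum (I : Type) (s : seq I) (f : I -> 'rV[R]_d -> R) :
  (forall i, L1 (f i)) -> L1 (fun u => \sum_(i <- s) f i u).
Proof.
move=> hf; rewrite (_ : _ \o _ = (fun u => \sum_(i <- s) (f i u)%:E)%E).
  by apply: integrable_sum => // i _; exact: hf.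
by apply/funext => u /=; rewrite sumEFin.
Qed.

Lemma Rintegral_sum (I : Type) (s : seq I) (f : I -> 'rV[R]_d -> R) :
  (forall i, L1 (f i)) ->
  \int[mu]_u (\sum_(i <- s) f i u) = \sum_(i <- s) \int[mu]_u f i u.
Proof.
move=> hf; elim: s => [|i s ih].
  rewrite big_nil (_ : (fun _ => _) = cst 0) ?Rintegral_cst ?mul0r//.
  by apply/funext => u /=; rewrite big_nil.
rewrite big_cons -ih -RintegralD//; last exact: L1_sum.
by congr Rintegral; apply/funext => u; rewrite big_cons.
Qed.

Lemma L1_reflect g x : L1 g -> L1 (fun z => g (x - z)).
Proof.
move=> hg; rewrite (_ : (fun z => _) = (fun z => g (x + (-1) *: z))).
  by apply: integrable_lebesgueRd_affine; rewrite // oppr_eq0 oner_eq0.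
by apply/funext => z; rewrite scaleN1r.
Qed.

Lemma Rintegral_reflect g x : L1 g ->
  \int[mu]_z g (x - (z : 'rV[R]_d)) = \int[mu]_z g z.
Proof.
move=> hg.
have h : (-1 : R) != 0 by rewrite oppr_eq0 oner_eq0.
have := Rintegral_lebesgueRd_affine x h hg.
rewrite normrN1 expr1n invr1 mul1r => <-.
by congr Rintegral; apply/funext => z; rewrite scaleN1r.
Qed.

Section bounded.
Variables (W : 'rV[R]_d -> R) (M : R).
Hypothesis mW : measurable_fun [set: borelRd R d] (W : borelRd R d -> R).
Hypothesis WM : forall z, `|W z| <= M.

Lemma L1_mul_bounded g : L1 g -> L1 (fun z => g z * W z).
Proof.
move=> hg; have M0 : 0 <= M by exact: le_trans (WM 0).
apply: (le_integrable measurableT _ _ (L1Z M hg)).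
- apply/measurable_EFinP; apply: measurable_funM => //.
  by apply/measurable_EFinP; exact: measurable_int hg.
- move=> z _; rewrite /= lee_fin !normrM (ger0_norm M0) mulrC.
  by rewrite ler_wpM2r.
Qed.

Lemma L1_conv g x : L1 g -> L1 (fun z => g (x - z) * W z).
Proof. by move=> /(L1_reflect x); exact: L1_mul_bounded. Qed.

Lemma conv_bounded r x : L1 r -> `|conv r W x| <= M * \int[mu]_u `|r u|.
Proof.
move=> hr; rewrite (le_trans (le_normr_Rintegral _ (L1_conv x hr)))//.
have hn := integrable_norm hr.
rewrite -(Rintegral_reflect x hn) -RintegralZl//; last exact: L1_reflect hn.
apply: le_Rintegral => //.
- exact: (integrable_norm (L1_conv x hr)).
- by apply: L1Z; exact: (L1_reflect x hn).
- by move=> z _; rewrite normrM mulrC ler_wpM2r.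
Qed.

Lemma convB f g x : L1 f -> L1 g ->
  conv (fun u => f u - g u) W x = conv f W x - conv g W x.
Proof.
move=> hf hg; rewrite /conv -RintegralB//; [|exact: L1_conv..].
by congr Rintegral; apply/funext => z; rewrite mulrBl.
Qed.

Lemma conv_lincomb (I : Type) (s : seq I) (k : I -> R)
    (f : I -> 'rV[R]_d -> R) x : (forall i, L1 (f i)) ->
  conv (fun u => \sum_(i <- s) k i * f i u) W x =
  \sum_(i <- s) k i * conv (f i) W x.
Proof.
move=> hf; rewrite /conv.
under [RHS]eq_bigr => i _ do rewrite -RintegralZl ?L1_conv//.
rewrite -Rintegral_sum; last by move=> i; apply/L1Z/L1_conv.
congr Rintegral; apply/funext => z; rewrite mulr_suml.
by apply: eq_bigr => i _; rewrite mulrA.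
Qed.

(** A translation of the argument is moved to the factor W, whose regularity
    is known along grid vectors. *)
Lemma conv_shift g x h : L1 g -> conv g W (x + h) = conv g (fun z => W (z + h)) x.
Proof.
move=> hg; have := Rintegral_lebesgueRd_affine h (oner_neq0 R) (L1_conv (x + h) hg).
rewrite normr1 expr1n invr1 mul1r => {}hg; rewrite {1}/conv -hg.
congr Rintegral; apply/funext => z; rewrite scale1r [h + _]addrC.
by rewrite opprD (addrC (- _)) addrA addrK.
Qed.

(** The remainder of conv g W at x is the convolution with W of the remainder
    of g, so it is at most M times the L^1 bound of L1_taylor1, which is
    quadratic in h. *)
Lemma conv_differentiable g :
  (forall x, differentiable g x) ->
  (forall i x, differentiable (fun z => 'D_(ebase R i) g z) x) ->
  (forall i j, continuous (fun y =>
     'D_(ebase R j) (fun z => 'D_(ebase R i) g z) y)) ->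
  L1 g -> (forall i, L1 (fun z => 'D_(ebase R i) g z)) ->
  (forall i j, L1 (fun y => 'D_(ebase R j) (fun z => 'D_(ebase R i) g z) y)) ->
  forall x, differentiable (conv g W) x /\
    forall v, 'D_v (conv g W) x =
              \sum_i v 0 i * conv (fun z => 'D_(ebase R i) g z) W x.
Proof.
move=> dg dgi cgij hg hgi hgij x.
have M0 : 0 <= M by exact: le_trans (WM 0).
pose g1 v u := \sum_i v 0 i * 'D_(ebase R i) g u.
pose g2 v u := \sum_i v 0 i *
  \sum_j v 0 j * 'D_(ebase R j) (fun z => 'D_(ebase R i) g z) u.
pose A i j := \int[mu]_u
  `|'D_(ebase R j) (fun z => 'D_(ebase R i) g z) (u : 'rV[R]_d)|.
have A0 i j : 0 <= A i j by exact: Rintegral_ge0.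
have dg1 v u : is_derive u v g (g1 v u).
  by rewrite /g1 -(derive_partials v (dg u)); exact: differentiable_is_derive.
have dg2 v u : is_derive u v (g1 v) (g2 v u).
  rewrite (_ : g1 v = \sum_i (v 0 i *: (fun z => 'D_(ebase R i) g z))); last first.
    by apply/funext => z; rewrite fct_sumE.
  rewrite /g2; apply: is_derive_sum => i; apply: is_deriveZ.
  by rewrite -(derive_partials v (dgi i u)); exact: differentiable_is_derive.
have cg : continuous g by move=> u; exact: differentiable_continuous.
have cg1 v : continuous (g1 v).
  apply: (@continuous_lincomb R 'rV[R]_d) => i u.
  exact: differentiable_continuous.
have cg2 v : continuous (g2 v).
  apply: (@continuous_lincomb R 'rV[R]_d) => i.
  by apply: (@continuous_lincomb R 'rV[R]_d) => j; exact: cgij.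
have hgh h : L1 (fun u => g (u + h)).
  rewrite (_ : (fun u => _) = (fun u => g (h + 1 *: u))).
    by apply: integrable_lebesgueRd_affine; rewrite // oner_neq0.
  by apply/funext => u; rewrite scale1r addrC.
have hg1 h : L1 (g1 h) by apply: L1_sum => i; exact: L1Z.
have hg2 h : L1 (g2 h).
  by apply: L1_sum => i; apply: L1Z; apply: L1_sum => j; exact: L1Z.
apply: (quadratic_remainder_diff (c := M * \sum_i \sum_j A i j)).
- move=> a u v; rewrite scaler_sumr -big_split/=; apply: eq_bigr => i _.
  by rewrite !mxE mulrDl -[_ *: (_ * _)]/(_ * (_ * _)) mulrA.
- rewrite (_ : (fun v => _) = (fun v : 'rV[R]_d =>
    \sum_i conv (fun z => 'D_(ebase R i) g z) W x * v 0 i)).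
    apply: (@continuous_lincomb R 'rV[R]_d) => i u; exact: coord_continuous.
  by apply/funext => v; apply: eq_bigr => i _; rewrite mulrC.
move=> h.
rewrite (_ : conv g W (x + h) = conv (fun u => g (u + h)) W x); last first.
  by congr Rintegral; apply/funext => z; rewrite addrAC.
rewrite -conv_lincomb// -convB//.
rewrite -(convB x (L1B (hgh h) hg) (hg1 h)).
rewrite (le_trans (conv_bounded _ (L1B (L1B (hgh h) hg) (hg1 h))))//.
rewrite -mulrA ler_wpM2l//.
apply: (@le_trans _ _ (\int[mu]_u `|g2 h u|)).
  apply: fine_le.
  - exact: (integrable_fin_num measurableT
      (integrable_norm (L1B (L1B (hgh h) hg) (hg1 h)))).
  - exact: (integrable_fin_num measurableT (integrable_norm (hg2 h))).
  - exact: (L1_taylor1 (dg1 h) (dg2 h) cg (cg1 h) (cg2 h)).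
have hn i j : L1 (fun y => `|'D_(ebase R j) (fun z => 'D_(ebase R i) g z) y|).
  exact: (integrable_norm (hgij i j)).
rewrite mulr_suml /A.
under eq_bigr => i _.
  rewrite mulrC -Rintegral_sum// -RintegralZl//; last exact: L1_sum.
  over.
rewrite -Rintegral_sum; last by move=> i; apply: L1Z; exact: L1_sum.
apply: le_Rintegral => //.
- exact: (integrable_norm (hg2 h)).
- by apply: L1_sum => i; apply: L1Z; exact: L1_sum.
move=> u _; rewrite (le_trans (ler_norm_sum _ _ _))//; apply: ler_sum => i _.
rewrite normrM (le_trans (ler_wpM2l _ (ler_norm_sum _ _ _)))// !mulr_sumr.
apply: ler_sum => j _; rewrite normrM mulrA ler_wpM2r// expr2.
by rewrite ler_pM// norm_coord.
Qed.
End bounded.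

Section regularity.
Variables (W : 'rV[R]_d -> R) (M : R).
Hypothesis mW : measurable_fun [set: borelRd R d] (W : borelRd R d -> R).
Hypothesis WM : forall z, `|W z| <= M.

Lemma measurable_translate (h : 'rV[R]_d) : measurable_fun [set: borelRd R d]
  ((fun z : 'rV[R]_d => W (z + h)) : borelRd R d -> R).
Proof.
rewrite (_ : (fun z => _) = (fun z : 'rV[R]_d => W (h + 1 *: z))).
  exact: measurable_affine.
by apply/funext => z; rewrite scale1r addrC.
Qed.

Lemma conv_lipschitz g h (K : R) x : L1 g ->
  (forall z, `|W (z + h) - W z| <= K) ->
  `|conv g W (x + h) - conv g W x| <= K * \int[mu]_u `|g u|.
Proof.
move=> hg hK; rewrite (conv_shift mW WM)//.
have mWh := measurable_translate h.
rewrite /conv -RintegralB//.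
- rewrite (_ : (fun z => _) =
    (fun z : 'rV[R]_d => g (x - z) * (W (z + h) - W z))).
    by apply: conv_bounded => //; exact: measurable_funB.
  by apply/funext => z; rewrite mulrBr.
- exact: (L1_conv mWh (fun z => WM (z + h))).
- exact: (L1_conv mW WM).
Qed.

(** Averaging against a nonnegative kernel keeps one-sided bounds on second
    differences. *)
Lemma conv_second_difference g h (C : R) x : L1 g -> (forall u, 0 <= g u) ->
  (forall z, W (z + h) - 2 * W z + W (z - h) <= C) ->
  conv g W (x + h) - 2 * conv g W x + conv g W (x - h) <= C * \int[mu]_u g u.
Proof.
move=> hg g0 hC; rewrite !(conv_shift mW WM)//.
have i1 := L1_conv (measurable_translate h) (fun z => WM (z + h)) x hg.
have i2 := L1_conv (measurable_translate (- h)) (fun z => WM (z - h)) x hg.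
have i0 := L1_conv mW WM x hg.
have i3 : L1 (fun z => - 2 * (g (x - z) * W z)) by exact: L1Z.
have i4 : L1 (fun z => g (x - z) * W (z + h) + - 2 * (g (x - z) * W z)).
  exact: (integrableD measurableT i1 i3).
have i5 : L1 (fun z => g (x - z) * W (z + h) + - 2 * (g (x - z) * W z) +
    g (x - z) * W (z - h)).
  exact: (integrableD measurableT i4 i2).
rewrite (_ : _ + _ = \int[mu]_z (g (x - (z : 'rV[R]_d)) * W ((z : 'rV[R]_d) + h) +
    - 2 * (g (x - (z : 'rV[R]_d)) * W z) +
    g (x - (z : 'rV[R]_d)) * W ((z : 'rV[R]_d) - h))); last first.
  by rewrite RintegralD// RintegralD// RintegralZl// mulNr.
rewrite -(Rintegral_reflect x hg) -RintegralZl//; last exact: L1_reflect.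
apply: le_Rintegral => //.
  by apply: L1Z; exact: L1_reflect.
move=> z _; rewrite [leRHS]mulrC (le_trans _ (ler_wpM2l (g0 _) (hC z)))//.
by rewrite le_eqVlt; apply/orP; left; apply/eqP; ring.
Qed.

End regularity.
End convolution.

Section mollified.
Context (R : realType) (d : nat) (rho W : 'rV[R]_d -> R) (M : R).
Local Notation mu := (lebesgueRd R d).
Hypothesis hrho : mollifier rho.
Hypothesis mW : measurable_fun [set: borelRd R d] (W : borelRd R d -> R).
Hypothesis WM : forall z, `|W z| <= M.
Implicit Types s : seq 'I_d.

Lemma of_class_partials k s : of_class k (partials s rho).
Proof.
elim: s k => [|i s ih] k; first by case: hrho => h _ _ _ _; exact: h.
by have [_] := ih k.+1; exact.
Qed.

Lemma differentiable_partials s x : differentiable (partials s rho) x.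
Proof. by have [h _] := of_class_partials 1 s. Qed.

Lemma integrable_partials s :
  mu.-integrable setT (EFin \o partials s rho).
Proof. by case: hrho => _ _ h _ _; exact: h. Qed.

Lemma conv_partials s x :
  differentiable (conv (partials s rho) W) x /\
  forall i, 'D_(ebase R i) (conv (partials s rho) W) x =
    conv (partials (i :: s) rho) W x.
Proof.
have [||||||df dE] := @conv_differentiable R d W M mW WM (partials s rho) _ _ _ _ _ _ x.
- exact: differentiable_partials.
- by move=> i; exact: (differentiable_partials (i :: s)).
- by move=> i j; exact: (of_class_partials 0 (j :: i :: s)).
- exact: integrable_partials.
- by move=> i; exact: (integrable_partials (i :: s)).
- by move=> i j; exact: (integrable_partials (j :: i :: s)).
split=> // i; rewrite dE (bigD1 i)//= big1 ?addr0.
  by rewrite /ebase mxE !eqxx mul1r.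
by move=> j ji; rewrite /ebase mxE (negbTE ji) andbF mul0r.
Qed.

(** Translations act on W, so the convolution is Lipschitz in each coordinate
    with constant K times the L^1 norm of the kernel, and its derivative inherits
    the bound.  Compared with the bound by the sup norm of W, the kernel is
    differentiated once less. *)
Lemma conv_partials_bounded (K : R) :
  (forall i z t, `|W (z + t *: ebase R i) - W z| <= K * `|t|) ->
  forall s i x, `|conv (partials (i :: s) rho) W x| <=
    K * \int[mu]_u `|partials s rho u|.
Proof.
move=> hK s i x; have [df dE] := conv_partials s x.
rewrite -dE.
have := differentiable_is_derive (ebase R i) df.
rewrite dE => -[der <-].
set C := K * _.
have : (fun h : R => `|h^-1 *: ((conv (partials s rho) W \o shift x) (h *: ebase R i)
   - conv (partials s rho) W x)|) @ 0^' -->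
   `|'D_(ebase R i) (conv (partials s rho) W) x|.
  by apply: cvg_norm; exact: der.
move=> cv; apply: (cvgr_to_le cv).
near=> h.
have h0 : h != 0 by near: h; exact: nbhs_dnbhs_neq.
rewrite normrM normfV ler_pdivrMl ?normr_gt0//= [h *: _ + x]addrC.
rewrite /C mulrA [_ * K]mulrC.
apply: conv_lipschitz => //; exact: integrable_partials.
Unshelve. all: by end_near. Qed.
End mollified.

(** * Taylor estimates for mollified functions *)

Lemma mvt_le (R : realType) (f f' : R -> R) (B : R) :
  (forall t : R, is_derive t (1 : R) f (f' t)) ->
  (forall t, 0 <= t <= 1 -> `|f' t| <= B) ->
  forall t, 0 <= t <= 1 -> `|f t - f 0| <= B.
Proof.
move=> df f'B t /andP[t0 t1].
have B0 : 0 <= B by apply: (le_trans (normr_ge0 (f' 0))); apply: f'B; rewrite lexx ler01.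
have [c|c] := @MVT_segment R f f' 0 t t0 (fun s _ => df s).
  by apply: derivable_within_continuous => s _.
rewrite in_itv/= subr0 => /andP[c0 ct] ->.
rewrite normrM (ger0_norm t0) -[leRHS]mulr1 ler_pM//.
by apply: f'B; rewrite c0 (le_trans ct t1).
Qed.

Lemma is_derive_reflect (R : realType) (f : R -> R) (a t : R) :
  is_derive (- t) (1 : R) f a -> is_derive t (1 : R) (fun s => f (- s)) (- a).
Proof.
move=> df; rewrite -mulrN1.
by apply: (@is_derive1_comp R f -%R).
Qed.

Lemma is_derive_mulr (R : realType) (c t : R) :
  is_derive t (1 : R) (fun s : R => s * c) c.
Proof.
rewrite (_ : (fun s => _) = c *: (@id R)).
  rewrite -[X in is_derive _ _ _ X]mulr1; exact: is_deriveZ.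
by apply/funext => s; rewrite mulrC.
Qed.

Lemma is_derive_sqr_mulr (R : realType) (c t : R) :
  is_derive t (1 : R) (fun s : R => s ^+ 2 * c) (t * (2 * c)).
Proof.
rewrite (_ : (fun s => _) = c *: ((@id R) ^+ 2)); last first.
  by apply/funext => s; rewrite mulrC.
apply: is_derive_eq; rewrite -[LHS]/(c * (2%:R * t ^+ 1 * 1)) expr1; ring.
Qed.

(** The function p0 t + p0 (- t) - t^2 p2 0 and its first three derivatives
    take the value 0 at 0, up to an additive constant for the function itself.
    Since its fourth derivative is bounded by 2 B, four applications of the mean
    value inequality bound its increment on the unit interval by 2 B. *)
Lemma symmetric_taylor (R : realType) (p0 p1 p2 p3 p4 : R -> R) (B : R) :
  (forall t : R, is_derive t (1 : R) p0 (p1 t)) ->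
  (forall t : R, is_derive t (1 : R) p1 (p2 t)) ->
  (forall t : R, is_derive t (1 : R) p2 (p3 t)) ->
  (forall t : R, is_derive t (1 : R) p3 (p4 t)) ->
  (forall t, `|p4 t| <= B) ->
  p2 0 <= p0 1 + p0 (-1) - 2 * p0 0 + 2 * B.
Proof.
move=> d0 d1 d2 d3 hB.
pose q3 t := p3 t - p3 (- t).
pose q2 t := p2 t + p2 (- t) - 2 * p2 0.
pose q1 t := p1 t - p1 (- t) - t * (2 * p2 0).
pose q0 t := p0 t + p0 (- t) - t ^+ 2 * p2 0.
have h3 (t : R) : 0 <= t <= 1 -> `|q3 t| <= 2 * B.
  have -> : q3 t = q3 t - q3 0 by rewrite /q3 oppr0 subrr subr0.
  apply: (mvt_le (f' := fun t => p4 t + p4 (- t))) => s.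
    rewrite -(opprK (p4 (- s))); apply: is_deriveB.
    exact: is_derive_reflect.
  by move=> _; rewrite (le_trans (ler_normD _ _))// mulr_natl mulr2n lerD.
have h2 (t : R) : 0 <= t <= 1 -> `|q2 t| <= 2 * B.
  have -> : q2 t = q2 t - q2 0 by rewrite /q2 oppr0; ring.
  apply: (mvt_le (f' := q3)) => // s.
  rewrite /q3 -[X in is_derive _ _ _ X]subr0; apply: is_deriveB.
  by apply: is_deriveD; exact: is_derive_reflect.
have h1 (t : R) : 0 <= t <= 1 -> `|q1 t| <= 2 * B.
  have -> : q1 t = q1 t - q1 0 by rewrite /q1 oppr0; ring.
  apply: (mvt_le (f' := q2)) => // s.
  rewrite /q2 -(opprK (p2 (- s))); apply: is_deriveB.
    by apply: is_deriveB; exact: is_derive_reflect.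
  exact: is_derive_mulr.
have h0 : `|q0 1 - q0 0| <= 2 * B.
  apply: (mvt_le (f' := q1)) => //; last by rewrite ler01 lexx.
  move=> s; rewrite /q1; apply: is_deriveB.
    by apply: is_deriveD; exact: is_derive_reflect.
  exact: is_derive_sqr_mulr.
move: h0; rewrite ler_norml /q0 oppr0 => /andP[+ _].
rewrite expr1n expr0n/=; lra.
Qed.

Lemma first_order_taylor (R : realType) (p0 p1 p2 : R -> R) (B : R) :
  (forall t : R, is_derive t (1 : R) p0 (p1 t)) ->
  (forall t : R, is_derive t (1 : R) p1 (p2 t)) ->
  (forall t, `|p2 t| <= B) ->
  p0 0 + p1 0 - B <= p0 1.
Proof.
move=> d0 d1 hB.
have : `|(p0 1 - 1 * p1 0) - (p0 0 - 0 * p1 0)| <= B.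
  apply: (mvt_le (f := fun t => p0 t - t * p1 0) (f' := fun t => p1 t - p1 0)).
  - by move=> t; apply: is_deriveB; exact: is_derive_mulr.
  - by apply: mvt_le => // t _.
  - by rewrite ler01 lexx.
rewrite ler_norml => /andP[+ _]; lra.
Qed.

Section directional.
Context (R : realType) (d : nat) (rho W : 'rV[R]_d -> R) (M : R).
Hypothesis hrho : mollifier rho.
Hypothesis mW : measurable_fun [set: borelRd R d] (W : borelRd R d -> R).
Hypothesis WM : forall z, `|W z| <= M.
Implicit Types (s : seq 'I_d) (x y : 'rV[R]_d).

(** The k-th derivative in the direction y of conv (partials s rho) W.  The
    list s accumulates the coordinates, so that each of the d^k terms is again
    a convolution with a derivative of rho. *)
Fixpoint dir_derive (k : nat) s y x : R :=
  if k is k'.+1 then \sum_i y 0 i * dir_derive k' (i :: s) y x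
  else conv (partials s rho) W x.

Lemma is_derive_dir_derive k s y x : is_derive x y (dir_derive k s y) (dir_derive k.+1 s y x).
Proof.
elim: k s => [|k ih] s /=.
  have [df dE] := conv_partials hrho mW WM s x.
  under eq_bigr => i _ do rewrite -dE.
  by rewrite -(derive_partials y df); exact: differentiable_is_derive.
rewrite (_ : (fun x0 => _) = \sum_i (y 0 i *: dir_derive k (i :: s) y)); last first.
  by apply/funext => z; rewrite fct_sumE.
apply: is_derive_sum => i; apply: is_deriveZ; exact: ih.
Qed.

Lemma is_derive_dir_derive_line k s y x (t : R) :
  is_derive t (1 : R) (fun r : R => dir_derive k s y (x + r *: y))
    (dir_derive k.+1 s y (x + t *: y)).
Proof. by apply: is_derive_line; exact: is_derive_dir_derive. Qed.

Lemma dir_derive_bounded k s y x (B : R) :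
  (forall s', size s' = (k + size s)%N ->
     forall u, `|conv (partials s' rho) W u| <= B) ->
  `|dir_derive k s y x| <= l1norm y ^+ k * B.
Proof.
elim: k s => [|k ih] s hB /=; first by rewrite mul1r; exact: hB.
rewrite (le_trans (ler_norm_sum _ _ _))// exprS -mulrA mulr_suml.
apply: ler_sum => i _; rewrite normrM ler_wpM2l//; apply: ih => s' hs'.
by apply: hB; rewrite hs' /= addnS.
Qed.

Lemma hessian_form_dir_derive x y : hessian_form (conv rho W) x y = dir_derive 2 [::] y x.
Proof.
rewrite hessian_formE /=; apply: eq_bigr => j _.
rewrite mulrC; congr (_ * _); apply: eq_bigr => i _; congr (_ * _).
rewrite (_ : (fun z => 'D_(ebase R j) (conv rho W) z) =
    conv (partials [:: j] rho) W).
  by have [_ ->] := conv_partials hrho mW WM [:: j] x.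
by apply/funext => z; have [_ ->] := conv_partials hrho mW WM [::] z.
Qed.

Lemma twice_differentiable_conv : twice_differentiable (conv rho W).
Proof.
split=> [x|i x]; first by have [] := conv_partials hrho mW WM [::] x.
rewrite (_ : (fun z => 'D_(ebase R i) (conv rho W) z) =
    conv (partials [:: i] rho) W).
  by have [] := conv_partials hrho mW WM [:: i] x.
by apply/funext => z; have [_ ->] := conv_partials hrho mW WM [::] z.
Qed.

Lemma hessian_le_second_difference x y (B4 : R) :
  (forall s, size s = 4%N -> forall u, `|conv (partials s rho) W u| <= B4) ->
  dir_derive 2 [::] y x <= conv rho W (x + y) + conv rho W (x - y) - 2 * conv rho W x
     + 2 * (l1norm y ^+ 4 * B4).
Proof.
move=> hB.
have D k t := is_derive_dir_derive_line k [::] y x t.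
have := symmetric_taylor (D 0) (D 1) (D 2) (D 3)
  (fun t => @dir_derive_bounded 4 [::] y (x + t *: y) B4 hB).
by rewrite scale0r addr0 scale1r scaleN1r.
Qed.

Lemma conv_first_order x e (B2 : R) :
  (forall s, size s = 2%N -> forall u, `|conv (partials s rho) W u| <= B2) ->
  conv rho W x + dir_derive 1 [::] e x - l1norm e ^+ 2 * B2 <= conv rho W (x + e).
Proof.
move=> hB.
have D k t := is_derive_dir_derive_line k [::] e x t.
have := first_order_taylor (D 0) (D 1) (fun t => @dir_derive_bounded 2 [::] e (x + t *: e) B2 hB).
by rewrite scale0r addr0 scale1r.
Qed.

End directional.

Section unit_scale.
Context (R : realType) (d : nat) (rho W : 'rV[R]_d -> R) (M : R).
Hypothesis hrho : mollifier rho.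
Hypothesis mW : measurable_fun [set: borelRd R d] (W : borelRd R d -> R).
Hypothesis WM : forall z, `|W z| <= M.

Lemma Rintegral_mollifier : \int[lebesgueRd R d]_u rho u = 1.
Proof. by case: hrho => _ _ _ _ h; rewrite /Rintegral h. Qed.

Section average.
Variables (I : finType) (w : I -> R) (z : I -> 'rV[R]_d) (y : 'rV[R]_d).
Variables (delta B2 : R).
Hypotheses (w_ge0 : forall b, 0 <= w b) (w_sum : \sum_b w b = 1).
Hypothesis w_mean : \sum_b w b *: z b = y.
Hypothesis z_near : forall b l, `|z b 0 l - y 0 l| <= delta.
Hypotheses (B2_ge0 : 0 <= B2) (hB2 : forall s, size s = 2%N ->
  forall u, `|conv (partials s rho) W u| <= B2).

(** The values at the points z b are compared with the value at their mean y.
    By first_order_taylor the error at z b is a linear term in z b - y, whose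
    weighted sum vanishes, plus a term of second order.  The sign c is 1 or -1,
    for the two outer points of a second difference. *)
Lemma conv_le_average (c : R) x : `|c| = 1 ->
  conv rho W (x + c *: y) - (d%:R * delta) ^+ 2 * B2 <=
  \sum_b w b * conv rho W (x + c *: z b).
Proof.
move=> c1.
have lin (e : 'rV[R]_d) u : dir_derive rho W 1 [::] e u =
    \sum_i e 0 i * conv (partials [:: i] rho) W u by [].
pose e b := c *: (z b - y).
(* the first order terms cancel because y is the mean of the z b *)
have e0 : \sum_b w b * dir_derive rho W 1 [::] (e b) (x + c *: y) = 0.
  under eq_bigr => b _ do rewrite lin mulr_sumr.
  rewrite exchange_big big1//= => i _.
  under eq_bigr => b _ do rewrite mulrA.
  rewrite -mulr_suml (_ : \sum_b _ = 0) ?mul0r//.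
  have /rowP/(_ i) : c *: (\sum_b w b *: (z b - y)) = 0.
    under eq_bigr do rewrite scalerBr.
    by rewrite sumrB w_mean -scaler_suml w_sum scale1r subrr scaler0.
  rewrite mxE summxE mulr_sumr mxE => {2}<-; apply: eq_bigr => b _.
  by rewrite !mxE; ring.
have -> : conv rho W (x + c *: y) - (d%:R * delta) ^+ 2 * B2 =
    \sum_b w b * (conv rho W (x + c *: y) - (d%:R * delta) ^+ 2 * B2 +
      dir_derive rho W 1 [::] (e b) (x + c *: y)).
  under [RHS]eq_bigr do rewrite mulrDr.
  by rewrite big_split/= e0 addr0 -mulr_suml w_sum mul1r.
apply: ler_sum => b _; rewrite ler_wpM2l//.
have := conv_first_order hrho mW WM (x + c *: y) (e b) hB2.
rewrite (_ : x + c *: y + e b = x + c *: z b); last first.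
  by rewrite -addrA; congr (_ + _); rewrite /e scalerBr addrC subrK.
apply: le_trans; rewrite addrAC lerD2l lerN2 ler_wpM2r//.
have h0 : 0 <= l1norm (e b) by apply: sumr_ge0.
have h1 : l1norm (e b) <= d%:R * delta.
  rewrite mulr_natl -[X in _ *+ X](card_ord d) -sumr_const.
  by apply: ler_sum => i _; rewrite !mxE normrM c1 mul1r; exact: z_near.
by rewrite ler_sqr ?nnegrE// (le_trans h0).
Qed.

(** W is only known to be semiconcave along the vectors z b, and y need not
    be one of them.  The average of the second differences of the convolution along
    the z b bounds the second difference along y by conv_le_average, and this
    one bounds the second derivative by hessian_le_second_difference. *)
Lemma hessian_le_average (C B4 : R) x : 0 <= C ->
  (forall b u, W (u + z b) - 2 * W u + W (u - z b) <= C * enorm (z b) ^+ 2) ->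
  (forall s, size s = 4%N -> forall u, `|conv (partials s rho) W u| <= B4) ->
  hessian_form (conv rho W) x y <=
    C * (2 * enorm y ^+ 2 + 2 * (d%:R * delta ^+ 2)) +
    2 * ((d%:R * delta) ^+ 2 * B2) + 2 * (l1norm y ^+ 4 * B4).
Proof.
move=> C0 hC hB4.
rewrite (hessian_form_dir_derive hrho mW WM).
rewrite (le_trans (hessian_le_second_difference hrho mW WM _ _ hB4))// lerD2r.
have h1 := conv_le_average x (normr1 R).
have h2 := conv_le_average x (normrN1 R).
rewrite scale1r in h1; rewrite scaleN1r in h2.
have avg (k : R) : k = \sum_b w b * k by rewrite -mulr_suml w_sum mul1r.
have h3 : \sum_b w b * conv rho W (x + 1 *: z b) +
   \sum_b w b * conv rho W (x + (-1) *: z b) - 2 * conv rho W x <=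
   C * (2 * enorm y ^+ 2 + 2 * (d%:R * delta ^+ 2)).
  rewrite [X in _ - X]avg [leRHS]avg -big_split -sumrB/=.
  apply: ler_sum => b _.
  rewrite -mulrDr -mulrBr ler_wpM2l// scale1r scaleN1r addrAC.
  have hr : forall u, 0 <= rho u by case: hrho.
  rewrite (le_trans (conv_second_difference mW WM x (integrable_partials hrho [::]) hr (hC b)))//.
  rewrite Rintegral_mollifier mulr1 ler_wpM2l//.
  rewrite !enorm_sqr.
  apply: (@le_trans _ _ (\sum_i (2 * y 0 i ^+ 2 + 2 * delta ^+ 2))).
    apply: ler_sum => i _.
    have : (z b 0 i - y 0 i) ^+ 2 <= delta ^+ 2.
      rewrite -(real_normK (num_real (_ - _))) ler_sqr ?nnegrE//.
      exact: le_trans (z_near b i).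
    have := sqr_ge0 (2 * y 0 i - z b 0 i).
    nra.
  rewrite big_split/= -mulr_sumr sumr_const card_ord lerD2l -[_ *+ d]mulr_natr.
  by rewrite -mulrA [delta ^+ 2 * _]mulrC.
lra.
Qed.
End average.
End unit_scale.

(** * Multilinear interpolation on the grid *)

Lemma int_lipschitz (R : realType) (A : int -> R) (k : R) :
  (forall n, `|A (n + 1) - A n| <= k) ->
  forall (m : int) (p : nat), `|A (m + p%:Z) - A m| <= k * p%:R.
Proof.
move=> hA m; elim=> [|p ih]; first by rewrite addr0 subrr normr0 mulr0.
rewrite (_ : m + p.+1%:Z = (m + p%:Z) + 1); last by lia.
rewrite -natr1 mulrDr mulr1 [leRHS]addrC.
rewrite (_ : A _ - A m = (A (m + p%:Z + 1) - A (m + p%:Z)) + (A (m + p%:Z) - A m)).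
  by rewrite (le_trans (ler_normD _ _))// lerD.
by rewrite addrA subrK.
Qed.

Definition affine_interp (R : realType) (A : int -> R) (r : R) : R :=
  (1 - (r - (Num.floor r)%:~R)) * A (Num.floor r) +
  (r - (Num.floor r)%:~R) * A (Num.floor r + 1).

(** When s and t lie in different cells, the increment splits at the right end
    of the cell of s and at the left end of the cell of t. *)
Lemma affine_interp_lipschitz (R : realType) (A : int -> R) (k : R) :
  (forall n, `|A (n + 1) - A n| <= k) ->
  forall s t : R, `|affine_interp A t - affine_interp A s| <= k * `|t - s|.
Proof.
move=> hA s t; wlog st : s t / s <= t => [hw|].
  have [st|ts] := leP s t; first exact: hw.
  by rewrite distrC [`|t - s|]distrC; apply: hw; exact: ltW.
have k0 : 0 <= k by exact: le_trans (hA 0).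
have fs : (Num.floor s)%:~R <= s by exact: floor_le_tmp.
have ft : (Num.floor t)%:~R <= t by exact: floor_le_tmp.
have fs1 : s < (Num.floor s)%:~R + 1 by rewrite -[X in _ + X]/(1%:~R) -intrD floorD1_gt.
have ft1 : t < (Num.floor t)%:~R + 1 by rewrite -[X in _ + X]/(1%:~R) -intrD floorD1_gt.
have fst : Num.floor s <= Num.floor t.
  by rewrite -ltzD1 -(ltr_int R) intrD; exact: le_lt_trans fs (le_lt_trans st ft1).
rewrite (ger0_norm (_ : 0 <= t - s)) ?subr_ge0//.
rewrite /affine_interp; move: fs ft fs1 ft1 fst.
set m := Num.floor s; set n := Num.floor t => fs ft fs1 ft1 mn.
have [mEn|mn1] : m = n \/ exists p : nat, n = m + 1 + p%:Z.
  have [mn_eq|/eqP nm] := eqVneq m n; first by left.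
  right; exists (absz (n - m - 1)%R); lia.
- rewrite -mEn in ft ft1 *.
  rewrite (_ : _ - _ = (t - s) * (A (m + 1) - A m)); last by ring.
  by rewrite normrM ger0_norm ?subr_ge0// [leLHS]mulrC ler_wpM2r ?subr_ge0.
case: mn1 => p np.
have nR : n%:~R = m%:~R + 1 + p%:R :> R by rewrite np !intrD.
have h1 := hA m; have h2 := hA n; have h3 := int_lipschitz hA (m + 1) p.
rewrite -np in h3.
rewrite (_ : _ - _ = (t - n%:~R) * (A (n + 1) - A n) + (A n - A (m + 1)) +
  (m%:~R + 1 - s) * (A (m + 1) - A m)); last by ring.
apply: (le_trans (ler_normD _ _)).
apply: (@le_trans _ _ (((t - n%:~R) * k + k * p%:R) + (m%:~R + 1 - s) * k)).
  apply: lerD.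
    apply: (le_trans (ler_normD _ _)); apply: lerD => //.
    by rewrite normrM ger0_norm ?subr_ge0// ler_wpM2l ?subr_ge0.
  have h4 : 0 <= m%:~R + 1 - s by rewrite subr_ge0 ltW.
  by rewrite normrM ger0_norm// ler_wpM2l.
rewrite nR; rewrite le_eqVlt; apply/orP; left; apply/eqP; ring.
Qed.

Section interpolation.
Context (R : realType) (d : nat).
Implicit Types (x : 'rV[R]_d) (i j : 'rV[int]_d) (phi : 'rV[int]_d -> R).

Definition cell (dx : R) x (l : 'I_d) : int := Num.floor (x 0 l / dx).

Definition cell_frac (dx : R) x (l : 'I_d) : R :=
  x 0 l / dx - (cell dx x l)%:~R.

Definition corner (dx : R) x (b : {ffun 'I_d -> bool}) : 'rV[int]_d :=
  \row_l (cell dx x l + (b l : nat)%:Z).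

Definition corner_weight (dx : R) x (b : {ffun 'I_d -> bool}) : R :=
  \prod_l (if b l then cell_frac dx x l else 1 - cell_frac dx x l).

Lemma cell_frac_itv dx x l : 0 <= cell_frac dx x l < 1.
Proof.
rewrite /cell_frac subr_ge0 floor_le_tmp/= ltrBlDl.
by have := floorD1_gt (x 0 l / dx); rewrite intrD.
Qed.

Lemma corner_weight_ge0 dx x b : 0 <= corner_weight dx x b.
Proof.
apply: prodr_ge0 => l _; have /andP[h0 h1] := cell_frac_itv dx x l.
by case: ifP => _ //; rewrite subr_ge0 ltW.
Qed.

Lemma sum_bool_prod (f : 'I_d -> bool -> R) :
  \sum_(b : {ffun 'I_d -> bool}) \prod_l f l (b l) =
  \prod_l (f l true + f l false).
Proof.
rewrite -(bigA_distr_bigA (fun l c => f l c))/=.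
by apply: eq_bigr => l _; rewrite big_bool.
Qed.

Lemma sum_corner_weight dx x : \sum_b corner_weight dx x b = 1.
Proof.
rewrite (sum_bool_prod (fun l (c : bool) =>
  if c then cell_frac dx x l else 1 - cell_frac dx x l)).
by rewrite big1// => l _; rewrite addrC subrK.
Qed.

(** The weights are those of independent coordinates, the l-th one being 1
    with probability cell_frac dx x l. *)
Lemma mean_corner dx x l :
  \sum_b corner_weight dx x b * (b l : nat)%:R = cell_frac dx x l.
Proof.
pose f k (c : bool) : R := (if c then cell_frac dx x k else 1 - cell_frac dx x k)
  * (if k == l then (c : nat)%:R else 1).
transitivity (\sum_(b : {ffun 'I_d -> bool}) \prod_k f k (b k)).
  apply: eq_bigr => b _; rewrite /f big_split/=; congr (_ * _).
  rewrite (bigD1 l)//= eqxx big1 ?mulr1// => k kl.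
  by rewrite (negbTE kl).
rewrite sum_bool_prod (bigD1 l)//= /f eqxx mulr1 mulr0 addr0 big1 ?mulr1//.
by move=> k kl; rewrite (negbTE kl) !mulr1 addrC subrK.
Qed.

Lemma corner_inj dx x : injective (corner dx x).
Proof.
move=> b c /rowP bc; apply/ffunP => l; have := bc l.
rewrite !mxE => /addrI.
by case: (b l); case: (c l).
Qed.

Lemma beta1_corner dx x b : beta1 dx (corner dx x b) x = corner_weight dx x b.
Proof.
apply: eq_bigr => l _; rewrite mxE intrD.
have /andP[h0 h1] := cell_frac_itv dx x l.
rewrite opprD addrA -/(cell_frac dx x l).
case: (b l) => /=; last by rewrite subr0 ger0_norm// max_r// subr_ge0 ltW.
by rewrite ler0_norm ?subr_le0 ?ltW// opprB subKr max_r.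
Qed.

Lemma beta1_eq0 dx x i : (forall b, i != corner dx x b) -> beta1 dx i x = 0.
Proof.
move=> hi.
have [l hl] : exists l, (i 0 l != cell dx x l) && (i 0 l != cell dx x l + 1).
  apply/existsP; apply: contraT; rewrite negb_exists => /forallP h.
  (* if every coordinate of i were one of the two nodes next to x, then i would
   be the corner selected by the coordinates that are not the lower node *)
  have := hi [ffun l => i 0 l != cell dx x l]; case/eqP.
  apply/rowP => l; rewrite !mxE ffunE.
  have := h l; rewrite negb_and !negbK => /orP[|] /eqP ->.
    by rewrite eqxx addr0.
  by rewrite -subr_eq0 addrAC subrr add0r.
have /andP[h0 h1] := cell_frac_itv dx x l.
rewrite /beta1 (bigD1 l)//= max_l ?mul0r// subr_le0.
case/andP: hl => n0 n1.
rewrite (_ : x 0 l / dx = cell_frac dx x l + (cell dx x l)%:~R); last first.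
  by rewrite subrK.
have [le|lt] := leP (i 0 l) (cell dx x l).
  have : (i 0 l)%:~R + 1 <= (cell dx x l)%:~R :> R.
    by rewrite -[X in _ + X]/(1%:~R) -intrD ler_int; lia.
  by move=> h; rewrite ger0_norm; lra.
have : (cell dx x l)%:~R + 2 <= (i 0 l)%:~R :> R.
  by rewrite -[X in _ + X]/(2%:~R) -intrD ler_int; lia.
by move=> h; rewrite ler0_norm; lra.
Qed.

(** The tensor hat functions that do not vanish at x are centred at the
    corners of the cell that contains x.  In this form the interpolant is an
    average over a finite type. *)
Lemma interp1_corner dx phi x :
  interp1 dx phi x = \sum_b corner_weight dx x b * phi (corner dx x b).
Proof.
rewrite /interp1.
rewrite (fsbigE [seq corner dx x b | b <- enum {: {ffun 'I_d -> bool}}])//.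
- rewrite (eq_bigl xpredT); last by move=> i; rewrite in_setT.
  rewrite big_map big_enum/=; apply: eq_bigr => b _.
  by rewrite beta1_corner mulrC.
- by rewrite map_inj_uniq ?enum_uniq//; exact: corner_inj.
- move=> i _ hi; rewrite beta1_eq0 ?mulr0// => b.
  apply: contra hi => /eqP ->; apply: map_f; exact: mem_enum.
Qed.

(** The grid and its hat functions are invariant under grid translations. *)
Lemma interp1_shift (dx : R) phi x j : dx != 0 ->
  interp1 dx phi (x + grid_point dx j) = interp1 dx (fun i => phi (i + j)) x.
Proof.
move=> dx0; rewrite /interp1 (reindex_fsbigT (fun i : 'rV[int]_d => i + j)).
  apply: eq_fsbigr => i _; congr (_ * _); apply: eq_bigr => l _.
  congr (Num.max _ (1 - `|_|)); rewrite !mxE intrD; field.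
  exact: dx0.
by exists (fun i => i - j) => i; rewrite ?addrK ?subrK.
Qed.

Lemma interp1_bounded dx phi x (M : R) : (forall i, `|phi i| <= M) ->
  `|interp1 dx phi x| <= M.
Proof.
move=> hM; rewrite interp1_corner (le_trans (ler_norm_sum _ _ _))//.
rewrite -[leRHS]mul1r -(sum_corner_weight dx x) mulr_suml.
apply: ler_sum => b _; rewrite normrM ger0_norm ?corner_weight_ge0//.
by rewrite ler_wpM2l// corner_weight_ge0.
Qed.

Lemma interp1B dx phi psi x :
  interp1 dx phi x - interp1 dx psi x = interp1 dx (fun i => phi i - psi i) x.
Proof.
by rewrite !interp1_corner -sumrB; apply: eq_bigr => b _; rewrite mulrBr.
Qed.

Lemma interp1_second_difference_le (dx : R) phi x j (c : R) : dx != 0 ->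
  (forall i, phi (i + j) - 2 * phi i + phi (i - j) <= c) ->
  interp1 dx phi (x + grid_point dx j) - 2 * interp1 dx phi x +
    interp1 dx phi (x - grid_point dx j) <= c.
Proof.
move=> dx0 hc; have -> : - grid_point dx j = grid_point dx (- j).
  by rewrite /grid_point -scalerN; congr (_ *: _); apply/rowP => l;
     rewrite !mxE mulrNz.
rewrite !interp1_shift// !interp1_corner mulr_sumr -sumrB -big_split/=.
rewrite (_ : c = \sum_b corner_weight dx x b * c); last first.
  by rewrite -mulr_suml sum_corner_weight mul1r.
apply: ler_sum => b _; rewrite mulrCA -mulrBr -mulrDr ler_wpM2l//.
exact: corner_weight_ge0.
Qed.

Lemma interp1_grid_lipschitz (dx : R) phi x j (c : R) : dx != 0 ->
  (forall i, `|phi (i + j) - phi i| <= c) ->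
  `|interp1 dx phi (x + grid_point dx j) - interp1 dx phi x| <= c.
Proof.
by move=> dx0 hc; rewrite interp1_shift// interp1B; exact: interp1_bounded.
Qed.

Lemma corner_mean (dx : R) x : dx != 0 ->
  \sum_b corner_weight dx x b *: grid_point dx (corner dx x b) = x.
Proof.
move=> dx0; apply/rowP => l; rewrite summxE.
under eq_bigr => b _ do rewrite !mxE intrD mulrDr mulrDr.
rewrite big_split/= -mulr_suml sum_corner_weight mul1r.
under eq_bigr do rewrite mulrCA.
rewrite -mulr_sumr mean_corner /cell_frac -mulrDr addrC subrK.
by rewrite mulrC divfK.
Qed.

Lemma corner_near (dx : R) x b l : 0 < dx ->
  `|grid_point dx (corner dx x b) 0 l - x 0 l| <= dx.
Proof.
move=> dx0; rewrite !mxE intrD.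
rewrite (_ : _ - _ = dx * ((b l : nat)%:R - cell_frac dx x l)); last first.
  by rewrite /cell_frac; field; exact: lt0r_neq0.
rewrite normrM gtr0_norm// -[leRHS]mulr1 ler_pM2l//.
have /andP[h0 h1] := cell_frac_itv dx x l.
case: (b l); last by rewrite sub0r normrN ger0_norm// ltW.
have h2 : 0 <= 1 - cell_frac dx x l by rewrite subr_ge0 ltW.
by rewrite ger0_norm// lerBlDr lerDl.
Qed.

Section one_coordinate.
Variables (dx : R) (l : 'I_d).

Definition slice_weight x (b : {ffun 'I_d -> bool}) : R :=
  \prod_(k | k != l) (if b k then cell_frac dx x k else 1 - cell_frac dx x k).

Definition slice_corner x (b : {ffun 'I_d -> bool}) (n : int) : 'rV[int]_d :=
  \row_k (if k == l then n else cell dx x k + (b k : nat)%:Z).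

(** The values of the interpolant on the line through x in the direction of
    the l-th axis, at the crossings with the hyperplanes of the grid: along
    this line the interpolant is piecewise affine with these nodes. *)
Definition slice phi x (n : int) : R :=
  \sum_(b : {ffun 'I_d -> bool} | ~~ b l)
    slice_weight x b * phi (slice_corner x b n).

Lemma interp1_slice phi x :
  interp1 dx phi x = affine_interp (slice phi x) (x 0 l / dx).
Proof.
pose up (c : bool) (b : {ffun 'I_d -> bool}) : {ffun 'I_d -> bool} :=
  [ffun k => if k == l then c else b k].
have upE c b : up c b l = c by rewrite ffunE eqxx.
have upN c b k : k != l -> up c b k = b k by move=> kl; rewrite ffunE (negbTE kl).
have weight c b : corner_weight dx x (up c b) =
    (if c then cell_frac dx x l else 1 - cell_frac dx x l) * slice_weight x b.
  rewrite /corner_weight (bigD1 l)//= upE; congr (_ * _).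
  by apply: eq_bigr => k kl; rewrite upN.
have pt c b : corner dx x (up c b) = slice_corner x b (cell dx x l + (c : nat)%:Z).
  apply/rowP => k; rewrite !mxE; case: eqP => [->|/eqP kl]; first by rewrite upE.
  by rewrite upN.
have up0 (b : {ffun 'I_d -> bool}) : ~~ b l -> up false b = b.
  move=> bl; apply/ffunP => k; rewrite ffunE; case: eqP => // ->.
  by rewrite (negbTE bl).
rewrite interp1_corner (bigID (fun b : {ffun 'I_d -> bool} => ~~ b l))/=.
rewrite /affine_interp -/(cell dx x l) -/(cell_frac dx x l) /slice !mulr_sumr.
congr (_ + _).
  apply: eq_bigr => b bl; rewrite -{1 2}(up0 _ bl) weight pt addr0 mulrA//.
rewrite (reindex_onto (up true) (up false)) /=; last first.
  move=> b; rewrite negbK => bl; apply/ffunP => k; rewrite !ffunE.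
  by case: eqP => // ->; rewrite bl.
apply: eq_big => [b|b _]; last by rewrite weight pt mulrA.
rewrite upE /=; apply/eqP/idP => [<-|bl]; first by rewrite upE.
apply/ffunP => k; rewrite !ffunE; case: eqP => // ->.
by rewrite (negbTE bl).
Qed.

Lemma sum_slice_weight x : \sum_(b : {ffun 'I_d -> bool} | ~~ b l) slice_weight x b = 1.
Proof.
have := interp1_slice (fun=> 1) x.
rewrite interp1_corner -mulr_suml sum_corner_weight mulr1 => ->.
have S n : slice (fun=> 1) x n =
    \sum_(b : {ffun 'I_d -> bool} | ~~ b l) slice_weight x b.
  by apply: eq_bigr => b _; rewrite mulr1.
by rewrite /affine_interp !S -mulrDl subrK mul1r.
Qed.

Lemma slice_weight_ge0 x b : 0 <= slice_weight x b.
Proof.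
apply: prodr_ge0 => k _; have /andP[h0 h1] := cell_frac_itv dx x k.
by case: ifP => _ //; rewrite subr_ge0 ltW.
Qed.

Lemma slice_move phi x t : slice phi (x + t *: ebase R l) = slice phi x.
Proof.
have e k : k != l -> (x + t *: ebase R l) 0 k = x 0 k.
  by move=> kl; rewrite !mxE (negbTE kl) andbF mulr0 addr0.
apply/funext => n; apply: eq_bigr => b _; congr (_ * phi _).
  by apply: eq_bigr => k kl; rewrite /cell_frac /cell e.
by apply/rowP => k; rewrite !mxE /cell; case: eqP => // /eqP kl; rewrite e.
Qed.

Lemma interp1_coord_lipschitz (K : R) phi : 0 < dx ->
  (forall i, `|phi (i + delta_mx 0 l) - phi i| <= K * dx) ->
  forall x t, `|interp1 dx phi (x + t *: ebase R l) - interp1 dx phi x| <=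
    K * `|t|.
Proof.
move=> dx0 hphi x t; rewrite !interp1_slice slice_move.
apply: (le_trans (affine_interp_lipschitz (k := K * dx) _ _ _)).
  move=> n; rewrite /slice -sumrB (le_trans (ler_norm_sum _ _ _))//.
  rewrite -[leRHS]mul1r -(sum_slice_weight x) mulr_suml.
  apply: ler_sum => b _; rewrite -mulrBr normrM.
  rewrite (ger0_norm (slice_weight_ge0 x b)) ler_wpM2l ?slice_weight_ge0//.
  rewrite (_ : slice_corner x b (n + 1) = slice_corner x b n + delta_mx 0 l)//.
  by apply/rowP => k; rewrite !mxE; case: eqP => _; rewrite ?addr0.
rewrite -mulrBl normrM normfV (gtr0_norm dx0) -mulrA (mulrC dx).
rewrite !mxE !eqxx mulr1 addrAC subrr add0r divfK//; exact: lt0r_neq0.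
Qed.

End one_coordinate.

End interpolation.

Lemma coord_lipschitz_continuous (R : realType) (d : nat) (f : 'rV[R]_d -> R)
    (K : R) :
  (forall x l t, `|f (x + t *: ebase R l) - f x| <= K * `|t|) -> continuous f.
Proof.
move=> fK.
have gen (V : normedModType R) (g : V -> R) (C : R) :
    (forall x h, `|g (x + h) - g x| <= C * `|h|) -> continuous g.
  move=> gC x; apply/cvgrPdist_le => e e0.
  have C1 : 0 < `|C| + 1 by rewrite ltr_wpDl.
  near=> y.
  have -> : y = x + (y - x) by rewrite addrC subrK.
  rewrite distrC (le_trans (gC _ _))//.
  rewrite (@le_trans _ _ ((`|C| + 1) * `|y - x|))//.
    by rewrite ler_wpM2r// (le_trans (ler_norm _))// lerDl.
  rewrite mulrC -ler_pdivlMr// distrC.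
  by near: y; apply: cvgr_dist_le; [exact: cvg_id|rewrite divr_gt0].
have chain (x h : 'rV[R]_d) (s : seq 'I_d) :
    `|f (x + \sum_(l <- s) h 0 l *: ebase R l) - f x| <=
    K * \sum_(l <- s) `|h 0 l|.
  elim: s x => [|l s ih] x; first by rewrite !big_nil addr0 subrr normr0 mulr0.
  rewrite !big_cons addrA mulrDr [leRHS]addrC.
  by rewrite (le_trans (ler_distD (f (x + h 0 l *: ebase R l)) _ _))// lerD.
have [d0|d0] := posnP d.
  by apply: (gen 'rV[R]_d _ 0) => x h; subst d; rewrite (thinmx0 h) addr0 subrr normr0 mul0r.
have K0 : 0 <= K.
  have := fK 0 (Ordinal d0) 1; rewrite normr1 mulr1; exact: le_trans.
apply: (gen 'rV[R]_d _ (K * d%:R)) => x h.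
rewrite {1}(rV_sum_ebase h) (le_trans (chain _ _ _))// -mulrA ler_wpM2l//.
rewrite mulr_natl -[X in _ *+ X](card_ord d) -sumr_const.
by apply: ler_sum => l _; exact: norm_coord.
Unshelve. all: by end_near. Qed.

(** * Infima of families of functions *)

Section infimum.
Context (R : realType) (T : Type) (A : set T) (a0 : T).
Hypothesis Aa0 : A a0.
Implicit Types f g : T -> R.

Definition infimum f : R := inf [set f a | a in A].

Lemma infimum_le f (m : R) a : (forall b, A b -> m <= f b) -> A a ->
  infimum f <= f a.
Proof.
move=> hm Aa; apply: ge_inf; last by exists a.
by exists m => _ [b Ab <-]; exact: hm.
Qed.

Lemma le_infimum f (m : R) : (forall b, A b -> m <= f b) -> m <= infimum f.
Proof.
move=> hm; apply: lb_le_inf; first by exists (f a0), a0.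
by move=> _ [b Ab <-]; exact: hm.
Qed.

Lemma infimum_dist f g (m m' c : R) :
  (forall b, A b -> m <= f b) -> (forall b, A b -> m' <= g b) ->
  (forall b, A b -> `|f b - g b| <= c) -> `|infimum f - infimum g| <= c.
Proof.
move=> hf hg hc; rewrite ler_norml; apply/andP; split.
  rewrite lerNl opprB lerBlDl -lerBlDr; apply: le_infimum => b Ab.
  rewrite lerBlDr; apply: (le_trans (infimum_le hg Ab)).
  by have := hc b Ab; rewrite ler_norml => /andP[+ _]; lra.
rewrite lerBlDr -lerBlDl; apply: le_infimum => b Ab.
rewrite lerBlDl; apply: (le_trans (infimum_le hf Ab)).
by have := hc b Ab; rewrite ler_norml => /andP[_]; lra.
Qed.

(** A bound for each fixed parameter suffices: at the outer points the infimum
    is at most the value of any parameter, and the parameter is chosen nearly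
    optimal at the middle point. *)
Lemma infimum_second_difference f g h (mf mh c : R) :
  (forall b, A b -> mf <= f b) -> (forall b, A b -> mh <= h b) ->
  (forall b, A b -> f b - 2 * g b + h b <= c) ->
  infimum f - 2 * infimum g + infimum h <= c.
Proof.
move=> hf hh hc.
suff : (infimum f + infimum h - c) / 2 <= infimum g by lra.
apply: le_infimum => b Ab.
by have := hc b Ab; have := infimum_le hf Ab; have := infimum_le hh Ab; lra.
Qed.

End infimum.

(** * The Lagrangian on bounded controls *)

(** By the mean value theorem applied to p0 t + p0 (- t), and then to p1. *)
Lemma second_difference_le (R : realType) (p0 p1 p2 : R -> R) (B : R) : 0 <= B ->
  (forall t : R, is_derive t (1 : R) p0 (p1 t)) ->
  (forall t : R, is_derive t (1 : R) p1 (p2 t)) ->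
  (forall t, p2 t <= B) ->
  p0 1 - 2 * p0 0 + p0 (-1) <= 2 * B.
Proof.
move=> B0 d0 d1 hB.
have dq (t : R) : is_derive t (1 : R) (fun t => p0 t + p0 (- t)) (p1 t - p1 (- t)).
  by apply: is_deriveD; exact: is_derive_reflect.
have cq : {within `[0, 1], continuous (fun t : R => p0 t + p0 (- t))}.
  apply: derivable_within_continuous => t _; exact: (@ex_derive _ _ _ _ _ _ _ (dq t)).
have [c] := MVT ltr01 (fun t _ => dq t) cq.
rewrite in_itv/= subr0 mulr1 oppr0 => /andP[c0 c1] e.
have c2 : - c < c by rewrite -subr_gt0 opprK addr_gt0.
have cp : {within `[- c, c], continuous p1}.
  by apply: derivable_within_continuous => t _.
have [r _ er] := MVT c2 (fun t _ => d1 t) cp.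
have h : p2 r * (c - - c) <= 2 * B.
  have := hB r; nra.
by rewrite -er -e in h; lra.
Qed.

Section lagrangian.
Context (R : realType) (d : nat) (L : 'rV[R]_d -> 'rV[R]_d -> R).
Hypothesis hL : lagrangian_hyp L.

Lemma differentiable_section (V V' : normedModType R) (f : V * V' -> R)
    (x : V) (a : V') :
  differentiable f (x, a) -> differentiable (fun y => f (y, a)) x.
Proof.
move=> df.
apply: (differentiable_comp (f := fun y : V => (y, a)) (g := f)) => //.
Qed.

(** A partial derivative in the first variable is a directional derivative
    on the product, which is where the regularity of L is assumed. *)
Lemma derive_section (V V' : normedModType R) (f : V * V' -> R)
    (v x : V) (a : V') :
  'D_v (fun y => f (y, a)) x = 'D_(v, 0) f (x, a).
Proof.
rewrite /derive (_ : (fun h : R => _) = (fun h : R =>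
  h^-1 *: ((f \o shift (x, a)) (h *: (v, 0 : V')) - f (x, a))))//.
apply/funext => h /=; congr (_ *: (f _ - _)).
by rewrite -[RHS]/(h *: v + x, h *: (0 : V') + a) scaler0 add0r.
Qed.

Lemma differentiable_lagrangian a x : differentiable (L ^~ a) x.
Proof.
case: hL => -[dL _] _ _.
exact: (@differentiable_section 'rV[R]_d 'rV[R]_d (fun z => L z.1 z.2)).
Qed.

Lemma differentiable_lagrangian_partial a i x :
  differentiable (fun z => 'D_(ebase R i) (L ^~ a) z) x.
Proof.
case: hL => -[_ dL] _ _.
have [h _] := dL (ebase R i, 0).
rewrite (_ : (fun z => _) = (fun z =>
   'D_(ebase R i, 0) (fun w : 'rV[R]_d * 'rV[R]_d => L w.1 w.2) (z, a))).
  exact: (@differentiable_section 'rV[R]_d 'rV[R]_d _ x a (h (x, a))).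
apply/funext => z.
exact: (@derive_section 'rV[R]_d 'rV[R]_d (fun z => L z.1 z.2)).
Qed.

End lagrangian.

Lemma second_difference_le_hessian (R : realType) (d : nat) (f : 'rV[R]_d -> R)
    (x h : 'rV[R]_d) (B : R) : twice_differentiable f -> 0 <= B ->
  (forall y, hessian_form f y h <= B) ->
  f (x + h) - 2 * f x + f (x - h) <= 2 * B.
Proof.
move=> [df ddf] B0 hB.
pose f1 y := \sum_i h 0 i * 'D_(ebase R i) f y.
have d0 y : is_derive y h f (f1 y).
  by rewrite /f1 -(derive_partials h (df y)); exact: differentiable_is_derive.
have d1 y : is_derive y h f1 (hessian_form f y h).
  rewrite (_ : f1 = \sum_i (h 0 i *: (fun z => 'D_(ebase R i) f z))); last first.
    by apply/funext => z; rewrite fct_sumE.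
  rewrite (_ : hessian_form f y h = \sum_i h 0 i *:
      'D_h (fun z => 'D_(ebase R i) f z) y).
    apply: is_derive_sum => i; apply: is_deriveZ.
    exact: differentiable_is_derive.
  apply: eq_bigr => j _; rewrite mxE mulrC; congr (_ * _).
  rewrite (derive_partials h (ddf j y)); apply: eq_bigr => i _.
  by rewrite !mxE.
have := @second_difference_le R (fun t => f (x + t *: h)) (fun t => f1 (x + t *: h))
  (fun t => hessian_form f (x + t *: h) h) B B0
  (fun t => is_derive_line (d0 (x + t *: h)))
  (fun t => is_derive_line (d1 (x + t *: h))) (fun t => hB _).
by rewrite scale0r addr0 scale1r scaleN1r.
Qed.

Lemma coord_difference_le_grad (R : realType) (d : nat) (f : 'rV[R]_d -> R)
    (x : 'rV[R]_d) i (t K : R) : (forall y, differentiable f y) -> 0 <= t ->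
  (forall y, enorm (grad f y) <= K) ->
  `|f (x + t *: ebase R i) - f x| <= K * t.
Proof.
move=> df t0 hK.
have dp (s : R) := is_derive_line (differentiable_is_derive (ebase R i)
  (df (x + s *: ebase R i))).
have cp : {within `[0, t], continuous (fun s : R => f (x + s *: ebase R i))}.
  apply: derivable_within_continuous => s _; exact: (@ex_derive _ _ _ _ _ _ _ (dp s)).
have [c _] := MVT_segment t0 (fun s _ => dp s) cp.
rewrite scale0r addr0 subr0 => ->; rewrite normrM (ger0_norm t0) ler_wpM2r//.
apply: le_trans (hK (x + c *: ebase R i)).
by apply: le_trans (abs_coord_le_enorm _ i); rewrite mxE.
Qed.

(** * Estimates for the scheme *)

Section scheme_estimates.
Context (R : realType) (d : nat).

Lemma grid_pointD (dx : R) (i j : 'rV[int]_d) :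
  grid_point dx (i + j) = grid_point dx i + grid_point dx j.
Proof. by rewrite /grid_point -scalerDr -map_mxD. Qed.

Lemma grid_pointN (dx : R) (i : 'rV[int]_d) :
  grid_point dx (- i) = - grid_point dx i.
Proof. by rewrite /grid_point -scalerN -map_mxN. Qed.

Lemma grid_point_delta (dx : R) (l : 'I_d) :
  grid_point dx (delta_mx 0 l) = dx *: ebase R l.
Proof.
by congr (_ *: _); apply/rowP => k; rewrite !mxE; case: (_ && _).
Qed.

Variables (T : R) (L : 'rV[R]_d -> 'rV[R]_d -> R) (F G : 'rV[R]_d -> P1 R d -> R).
Variables (Cb : R) (mu : R -> P1 R d) (N : nat) (dt dx : R).
Variables (BL KL SL BF KF SF BG KG SG : R).
Hypotheses (Cb0 : 0 <= Cb) (dt0 : 0 < dt) (dx0 : 0 < dx).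
Hypothesis L_lower : forall x a, - BL <= L x a.
Hypothesis L_upper0 : forall x, L x 0 <= BL.
Hypothesis L_lip : forall x a l, enorm a <= Cb ->
  `|L (x + dx *: ebase R l) a - L x a| <= KL * dx.
Hypothesis L_semi : forall x a h, enorm a <= Cb ->
  L (x + h) a - 2 * L x a + L (x - h) a <= SL * enorm h ^+ 2.
Hypothesis F_bnd : forall x nu, `|F x nu| <= BF.
Hypothesis F_lip : forall x y nu, `|F x nu - F y nu| <= KF * enorm (x - y).
Hypothesis F_semi : forall x h nu,
  F (x + h) nu - 2 * F x nu + F (x - h) nu <= SF * enorm h ^+ 2.
Hypothesis G_bnd : forall x nu, `|G x nu| <= BG.
Hypothesis G_lip : forall x y nu, `|G x nu - G y nu| <= KG * enorm (x - y).
Hypothesis G_semi : forall x h nu,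
  G (x + h) nu - 2 * G x nu + G (x - h) nu <= SG * enorm h ^+ 2.

Local Notation ball_Cb := [set a : 'rV[R]_d | enorm a <= Cb].
Local Notation v := (v_remaining T L F G Cb mu N dt dx).

Definition step_value n i (a : 'rV[R]_d) : R :=
  dt * L (grid_point dx i) a + interp1 dx (v n) (grid_point dx i - dt *: a).

Lemma v_remainingS n i : v n.+1 i =
  infimum ball_Cb (step_value n i) +
  dt * F (grid_point dx i) (mu ((N - n.+1)%N%:R * dt)).
Proof. by []. Qed.

Lemma ball0 : ball_Cb 0.
Proof. by rewrite /= -(scale0r 0) enormZ normr0 mul0r. Qed.

Lemma v_remaining_bounded n i : `|v n i| <= BG + n%:R * (dt * (BL + BF)).
Proof.
elim: n i => [|n ih] i; first by rewrite mul0r addr0; exact: G_bnd.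
rewrite v_remainingS; set M := BG + n%:R * (dt * (BL + BF)) in ih.
have hlow a : ball_Cb a -> - (dt * BL + M) <= step_value n i a.
  move=> _; rewrite /step_value opprD lerD// -?mulrN ?ler_pM2l//.
  by have := interp1_bounded dx (grid_point dx i - dt *: a) ih; rewrite ler_norml => /andP[].
have := le_infimum ball0 hlow; have := infimum_le hlow ball0.
have : step_value n i 0 <= dt * BL + M.
  rewrite /step_value lerD ?ler_pM2l//.
  by have := interp1_bounded dx (grid_point dx i - dt *: 0) ih; rewrite ler_norml => /andP[].
have := F_bnd (grid_point dx i) (mu ((N - n.+1)%N%:R * dt)).
rewrite !ler_norml -natr1 mulrDl mul1r addrA -/M mulrDr => /andP[f1 f2] s1 s2 s3.
have {f1} : dt * - BF <= dt * F (grid_point dx i) (mu ((N - n.+1)%N%:R * dt)).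
  by rewrite ler_pM2l.
have {f2} : dt * F (grid_point dx i) (mu ((N - n.+1)%N%:R * dt)) <= dt * BF.
  by rewrite ler_pM2l.
by move=> *; apply/andP; split; lra.
Qed.

Lemma step_value_lower n i a : ball_Cb a ->
  - (dt * BL + (BG + n%:R * (dt * (BL + BF)))) <= step_value n i a.
Proof.
move=> _; rewrite /step_value opprD lerD// -?mulrN ?ler_pM2l//.
by have := interp1_bounded dx (grid_point dx i - dt *: a) (v_remaining_bounded n);
   rewrite ler_norml => /andP[].
Qed.

(** One step adds dt times the Lipschitz constants of L and F: for a fixed
    control, moving from x_i to a neighbour translates the argument of the
    interpolant by a grid vector. *)
Lemma v_remaining_lipschitz n i l :
  `|v n (i + delta_mx 0 l) - v n i| <= (KG + n%:R * (dt * (KL + KF))) * dx.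
Proof.
have dxe (y : 'rV[R]_d) : enorm (y + dx *: ebase R l - y) = dx.
  by rewrite addrAC subrr add0r enormZ enorm_ebase mulr1 gtr0_norm.
elim: n i => [|n ih] i.
  rewrite mul0r addr0 /= grid_pointD grid_point_delta.
  by rewrite (le_trans (G_lip _ _ _))// dxe.
set K := KG + n%:R * (dt * (KL + KF)) in ih.
rewrite !v_remainingS opprD addrACA.
have h1 : `|infimum ball_Cb (step_value n (i + delta_mx 0 l)) -
    infimum ball_Cb (step_value n i)| <= dt * (KL * dx) + K * dx.
  apply: infimum_dist (@step_value_lower n _) (@step_value_lower n _) _.
    exact: ball0.
  move=> a aCb; rewrite /step_value opprD addrACA -mulrBr.
  rewrite (le_trans (ler_normD _ _))// lerD//.
    rewrite normrM gtr0_norm// ler_pM2l// grid_pointD grid_point_delta.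
    exact: L_lip.
  rewrite grid_pointD addrAC; apply: interp1_grid_lipschitz.
    exact: lt0r_neq0.
  by move=> k; exact: ih.
rewrite (le_trans (ler_normD _ _))// -mulrBr.
rewrite normrM (gtr0_norm dt0) grid_pointD grid_point_delta.
have h2 := F_lip (grid_point dx i + dx *: ebase R l) (grid_point dx i)
  (mu ((N - n.+1)%N%:R * dt)).
rewrite dxe in h2.
have {h2} := ler_wpM2l (ltW dt0) h2.
have -> : (KG + n.+1%:R * (dt * (KL + KF))) * dx =
    K * dx + dt * (KL * dx) + dt * (KF * dx) by rewrite /K -natr1; ring.
lra.
Qed.

(** One step adds dt times the semiconcavity constants of L and F: with the
    same control at the three points, the arguments of the interpolant differ
    by grid vectors. *)
Lemma v_remaining_semiconcave n i j :
  v n (i + j) - 2 * v n i + v n (i - j) <=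
  (SG + n%:R * (dt * (SL + SF))) * enorm (grid_point dx j) ^+ 2.
Proof.
elim: n i => [|n ih] i.
  by rewrite mul0r addr0 /= !grid_pointD grid_pointN.
set S := SG + n%:R * (dt * (SL + SF)) in ih.
have h1 : infimum ball_Cb (step_value n (i + j)) -
    2 * infimum ball_Cb (step_value n i) +
    infimum ball_Cb (step_value n (i - j)) <=
    dt * (SL * enorm (grid_point dx j) ^+ 2) + S * enorm (grid_point dx j) ^+ 2.
  apply: infimum_second_difference (@step_value_lower n _) (@step_value_lower n _) _.
    exact: ball0.
  move=> a aCb; rewrite /step_value !grid_pointD grid_pointN.
  rewrite (addrAC _ (grid_point dx j)) (addrAC _ (- grid_point dx j)).
  have := ler_wpM2l (ltW dt0) (L_semi (grid_point dx i) (grid_point dx j) aCb).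
  have := interp1_second_difference_le (grid_point dx i - dt *: a)
    (lt0r_neq0 dx0) ih.
  lra.
rewrite !v_remainingS !grid_pointD grid_pointN.
have := ler_wpM2l (ltW dt0) (F_semi (grid_point dx i) (grid_point dx j)
  (mu ((N - n.+1)%N%:R * dt))).
set e := enorm (grid_point dx j) ^+ 2 in h1 *.
have -> : (SG + n.+1%:R * (dt * (SL + SF))) * e =
    S * e + dt * (SL * e) + dt * (SF * e) by rewrite /S -natr1; ring.
lra.
Qed.

End scheme_estimates.

(** * Rescaling *)

Section rescaling.
Context (R : realType) (d : nat).
Implicit Types (x y : 'rV[R]_d).

Lemma derive_scale (f : 'rV[R]_d -> R) (c : R) x : differentiable f (c *: x) ->
  differentiable (fun z => f (c *: z)) x /\
  forall v, 'D_v (fun z => f (c *: z)) x = c * 'D_v f (c *: x).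
Proof.
move=> df.
have gen (V : normedModType R) (g : V -> R) (u : V) : differentiable g (c *: u) ->
    differentiable (fun z => g (c *: z)) u /\
    forall v, 'D_v (fun z => g (c *: z)) u = c * 'D_v g (c *: u).
  move=> dg.
  have ds : is_diff u ( *:%R c : V -> V) ( *:%R c) by exact: is_diff_scaler.
  have dgc : differentiable (fun z => g (c *: z)) u.
    by apply: (differentiable_comp (f := *:%R c) (g := g)).
  split=> // v; rewrite deriveE// deriveE//.
  rewrite (_ : (fun z => _) = g \o ( *:%R c))// diff_comp//=.
  by rewrite diff_val linearZ.
exact: (gen 'rV[R]_d).
Qed.

Lemma twice_differentiable_scale (f : 'rV[R]_d -> R) (c : R) :
  twice_differentiable f ->
  twice_differentiable (fun z => f (c *: z)) /\
  forall x y, hessian_form (fun z => f (c *: z)) x y =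
    c ^+ 2 * hessian_form f (c *: x) y.
Proof.
move=> [df ddf].
have e i : (fun z => 'D_(ebase R i) (fun z => f (c *: z)) z) =
    c *: (fun z => (fun u => 'D_(ebase R i) f u) (c *: z)).
  by apply/funext => z; have [_ ->] := derive_scale (df (c *: z)).
split.
  split=> [x|i x]; first by have [] := derive_scale (df (c *: x)).
  rewrite e; apply: differentiableZ.
  by have [] := derive_scale (ddf i (c *: x)).
move=> x y; rewrite !hessian_formE mulr_sumr; apply: eq_bigr => j _.
rewrite [RHS]mulrA; apply: (congr1 (fun a => a * y 0 j)).
rewrite mulr_sumr; apply: eq_bigr => i _.
rewrite [RHS]mulrCA; apply: (congr1 (fun a => y 0 i * a)).
have [h1 h2] := derive_scale (ddf j (c *: x)).
rewrite e deriveZ; last exact: diff_derivable.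
by rewrite h2 -[LHS]/(c * _) mulrA expr2.
Qed.

(** The change of variables z = eps u turns the mollification at scale eps
    into a convolution with rho itself. *)
Lemma v_mollified_conv T L F G Cb (mu : R -> P1 R d) N dt dx (rho : 'rV[R]_d -> R)
    (eps t M : R) : mollifier rho -> 0 < eps ->
  (forall z, `|v_interp T L F G Cb mu N dt dx t z| <= M) ->
  continuous (v_interp T L F G Cb mu N dt dx t) ->
  v_mollified T L F G Cb mu N dt dx rho eps t =
  (fun x => conv rho (fun u => v_interp T L F G Cb mu N dt dx t (eps *: u))
              (eps^-1 *: x)).
Proof.
move=> hrho eps0 wM cw; apply/funext => x; rewrite /v_mollified.
set w := v_interp T L F G Cb mu N dt dx t in wM cw *.
have ie : eps^-1 != 0 by rewrite invr_eq0 lt0r_neq0.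
have mW : measurable_fun [set: borelRd R d]
    ((fun u : 'rV[R]_d => w (eps *: u)) : borelRd R d -> R).
  rewrite (_ : (fun u => _) = (fun u : 'rV[R]_d => w (0 + eps *: u))).
    exact: (@measurable_affine R d w 0 eps (measurable_continuous cw)).
  by apply/funext => u; rewrite add0r.
have ig := L1_conv mW (fun u => wM (eps *: u)) (eps^-1 *: x)
  (integrable_partials hrho [::]).
have := Rintegral_lebesgueRd_affine 0 ie ig.
have iga := integrable_lebesgueRd_affine 0 ie ig.
rewrite normfV gtr0_norm// exprVn invrK => h.
have ed : eps ^+ d != 0 by rewrite expf_neq0// lt0r_neq0.
rewrite /conv -[RHS](mulKf ed) -h -RintegralZl//.
congr Rintegral; apply/funext => z.
rewrite add0r scalerA divff ?lt0r_neq0// scale1r /rescale mulrA.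
by rewrite scalerBr.
Qed.

End rescaling.

(** * The Hessian bound *)

Definition partials_mass (R : realType) (d : nat) (rho : 'rV[R]_d -> R) (n : nat) : R :=
  \sum_(s : n.-tuple 'I_d) \int[lebesgueRd R d]_u `|partials s rho u|.

Section grid_hessian.
Context (R : realType) (d : nat) (rho : 'rV[R]_d -> R).
Hypothesis hrho : mollifier rho.
Variables (dx eps M K C : R) (phi : 'rV[int]_d -> R).
Hypotheses (dx0 : 0 < dx) (eps0 : 0 < eps) (eps1 : eps < 1).
Hypotheses (K0 : 0 <= K) (C0 : 0 <= C).
Hypothesis phi_bnd : forall i, `|phi i| <= M.
Hypothesis phi_lip : forall i l, `|phi (i + delta_mx 0 l) - phi i| <= K * dx.
Hypothesis phi_semi : forall i j,
  phi (i + j) - 2 * phi i + phi (i - j) <= C * enorm (grid_point dx j) ^+ 2.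

Local Notation W := (fun u : 'rV[R]_d => interp1 dx phi (eps *: u)).
Local Notation A := (partials_mass rho).

Lemma partials_mass_ge0 n : 0 <= A n.
Proof. by apply: sumr_ge0 => s _; exact: Rintegral_ge0. Qed.

Lemma le_partials_mass n (s : seq 'I_d) : size s = n ->
  \int[lebesgueRd R d]_u `|partials s rho u| <= A n.
Proof.
move=> hs; have hs' : size s == n by rewrite hs.
rewrite /partials_mass (bigD1 (Tuple hs'))//= lerDl sumr_ge0// => s' _.
exact: Rintegral_ge0.
Qed.

Let W_lip l u t : `|W (u + t *: ebase R l) - W u| <= K * eps * `|t|.
Proof.
rewrite /= scalerDr scalerA -mulrA -[X in K * (X * _)](gtr0_norm eps0) -normrM.
exact: interp1_coord_lipschitz.
Qed.

Let W_measurable : measurable_fun [set: borelRd R d] (W : borelRd R d -> R).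
Proof.
apply: measurable_continuous; apply: (@coord_lipschitz_continuous R d _ (K * eps)).
by move=> u l t; exact: W_lip.
Qed.

Let W_bnd u : `|W u| <= M.
Proof. exact: interp1_bounded. Qed.

Let conv_bnd n s : size s = n.+1 ->
  forall u, `|conv (partials s rho) W u| <= K * eps * A n.
Proof.
case: s => [//|i s] [hs] u.
apply: (le_trans (conv_partials_bounded hrho W_measurable W_bnd _ s i u)).
  by move=> l z t; exact: W_lip.
by rewrite ler_wpM2l ?mulr_ge0// ?(ltW eps0)//; exact: le_partials_mass.
Qed.

Let W_semi j u : W (u + grid_point (dx / eps) j) - 2 * W u +
  W (u - grid_point (dx / eps) j) <=
  C * eps ^+ 2 * enorm (grid_point (dx / eps) j) ^+ 2.
Proof.
have e : eps *: grid_point (dx / eps) j = grid_point dx j.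
  by rewrite /grid_point scalerA mulrCA divff ?mulr1// lt0r_neq0.
rewrite /= scalerDr scalerBr e.
rewrite -mulrA -exprMn -[in X in _ <= _ * (X * _) ^+ 2](gtr0_norm eps0) -enormZ e.
by apply: interp1_second_difference_le; [exact: lt0r_neq0|].
Qed.

(** The vectors z b of hessian_le_average are the corners of the cell of y in
    the grid of step dx / eps. *)
Lemma conv_interp_hessian x y : enorm y ^+ 2 = eps ->
  hessian_form (conv rho W) x y <=
  C * eps ^+ 2 * (2 * eps + 2 * (d%:R * (dx / eps) ^+ 2)) +
  2 * ((d%:R * (dx / eps)) ^+ 2 * (K * eps * A 1)) +
  2 * ((d%:R * eps) ^+ 2 * (K * eps * A 3)).
Proof.
move=> ye.
have delta0 : 0 < dx / eps by rewrite divr_gt0.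
have Ke : 0 <= K * eps by rewrite mulr_ge0// ltW.
have := @hessian_le_average R d rho W M hrho W_measurable W_bnd _
  (corner_weight (dx / eps) y)
  (fun b => grid_point (dx / eps) (corner (dx / eps) y b)) y (dx / eps)
  (K * eps * A 1) (corner_weight_ge0 (dx / eps) y)
  (sum_corner_weight (dx / eps) y) (corner_mean y (lt0r_neq0 delta0))
  (fun b l => corner_near y b l delta0)
  (mulr_ge0 Ke (partials_mass_ge0 1)) (@conv_bnd 1)
  (C * eps ^+ 2) (K * eps * A 3) x
  (mulr_ge0 C0 (sqr_ge0 eps)) (fun b u => W_semi _ u) (@conv_bnd 3).
move=> /le_trans; apply; rewrite ye lerD2l ler_pM2l// ler_wpM2r//.
  by rewrite mulr_ge0// partials_mass_ge0.
rewrite (exprM _ 2 2) ler_sqr ?nnegrE ?sqr_ge0//.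
  by rewrite -ye; exact: l1norm_sqr.
by rewrite mulr_ge0// ltW.
Qed.

(** The direction y is first rescaled to have squared norm eps: at this size the
    Taylor error contributes a constant, and the replacement of y by grid
    vectors a multiple of dx^2 / eps^4. *)
Lemma mollified_interp_hessian :
  let f := fun x => conv rho W (eps^-1 *: x) in
  twice_differentiable f /\
  forall x y, hessian_form f x y <=
    (2 * C + 2 * (d%:R * C) + 2 * (d%:R ^+ 2 * (K * A 1)) +
     2 * (d%:R ^+ 2 * (K * A 3))) * (1 + dx ^+ 2 / eps ^+ 4) * enorm y ^+ 2.
Proof.
have [tf hf] := twice_differentiable_scale eps^-1
  (twice_differentiable_conv hrho W_measurable W_bnd).
split=> // x y; rewrite hf.
set P := _ + _ + _ + _.
have [y0|y0] := eqVneq (enorm y) 0.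
  rewrite y0 (enorm_eq0 y0) expr0n mulr0 hessian_formE big1 ?mulr0// => j _.
  by rewrite mxE mulr0.
have en0 : 0 < enorm y by rewrite lt_neqAle eq_sym y0 enorm_ge0.
(* scaling y by c gives it the squared norm eps *)
pose c := Num.sqrt eps / enorm y.
have ce : enorm (c *: y) ^+ 2 = eps.
  rewrite enormZ /c normrM normfV !ger0_norm ?enorm_ge0 ?sqrtr_ge0// divfK//.
  by rewrite sqr_sqrtr// ltW.
have := conv_interp_hessian (eps^-1 *: x) ce.
rewrite hessian_formZ.
have c2 : c ^+ 2 = eps / enorm y ^+ 2 by rewrite /c exprMn exprVn sqr_sqrtr// ltW.
rewrite c2; set h := hessian_form _ _ _ => hh.
have e3 : 0 < eps ^+ 3 / enorm y ^+ 2 by rewrite divr_gt0// exprn_gt0.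
rewrite -(ler_pM2l e3).
have -> : eps ^+ 3 / enorm y ^+ 2 * (eps^-1 ^+ 2 * h) = eps / enorm y ^+ 2 * h.
  by field; rewrite y0 lt0r_neq0.
rewrite (le_trans hh)//.
pose q := dx ^+ 2 / eps ^+ 4.
have q0 : 0 <= q by rewrite divr_ge0// ?sqr_ge0// exprn_ge0// ltW.
have -> : eps ^+ 3 / enorm y ^+ 2 * (P * (1 + dx ^+ 2 / eps ^+ 4) * enorm y ^+ 2) =
   eps ^+ 3 * (P * (1 + q)).
  by rewrite /q; field; rewrite y0 lt0r_neq0.
have -> : C * eps ^+ 2 * (2 * eps + 2 * (d%:R * (dx / eps) ^+ 2)) +
    2 * ((d%:R * (dx / eps)) ^+ 2 * (K * eps * A 1)) +
    2 * ((d%:R * eps) ^+ 2 * (K * eps * A 3)) =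
    eps ^+ 3 * (2 * C + 2 * (d%:R * C) * (q * eps) +
      2 * (d%:R ^+ 2 * (K * A 1)) * q + 2 * (d%:R ^+ 2 * (K * A 3))).
  by rewrite /q; field; rewrite lt0r_neq0.
rewrite ler_pM2l ?exprn_gt0//.
have qe : q * eps <= q by rewrite ler_piMr// ltW.
have dC : 0 <= d%:R * C by rewrite mulr_ge0.
have K1 : 0 <= d%:R ^+ 2 * (K * A 1).
  by rewrite mulr_ge0 ?sqr_ge0// mulr_ge0// partials_mass_ge0.
have K3 : 0 <= d%:R ^+ 2 * (K * A 3).
  by rewrite mulr_ge0 ?sqr_ge0// mulr_ge0// partials_mass_ge0.
rewrite /P; move: dC K1 K3; set a := d%:R * C.
set b := d%:R ^+ 2 * (K * A 1); set e := d%:R ^+ 2 * (K * A 3) => a0 b0 e0.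
have h1 := ler_wpM2l a0 qe.
have h2 := mulr_ge0 C0 q0.
have h3 := mulr_ge0 e0 q0.
nra.
Qed.

End grid_hessian.

Unset Implicit Arguments.

Theorem proposition3p5 (R : realType) (d : nat) (hd : (1 <= d)%N)
  (T : R) (hT : 0 < T)
  (L H : 'rV[R]_d -> 'rV[R]_d -> R) (F G : 'rV[R]_d -> P1 R d -> R)
  (hL : lagrangian_hyp L) (hH : forall x p, H x p = hamiltonian L x p)
  (hF : cost_hyp F) (hG : cost_hyp G)
  (Cb : R) (hCb : 0 < Cb) (hCb' : control_bound T L F G Cb)
  (rho : 'rV[R]_d -> R) (hrho : mollifier rho) :
  exists2 Chb : R, 0 < Chb &
  forall (mu : R -> P1 R d), continuous_flow T mu ->
  forall (dt dx eps : R) (N : nat), 0 < dt -> 0 < dx -> 0 < eps < 1 ->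
    (1 <= N)%N -> T / dt = N%:R ->
  forall t : R, 0 <= t <= T ->
    twice_differentiable (v_mollified T L F G Cb mu N dt dx rho eps t) /\
    forall x y : 'rV[R]_d,
      hessian_form (v_mollified T L F G Cb mu N dt dx rho eps t) x y
        <= Chb * (1 + dx ^+ 2 / eps ^+ 4) * enorm y ^+ 2.
Proof.
have dL a x := differentiable_lagrangian hL a x.
have ddL a i x := differentiable_lagrangian_partial hL a i x.
case: hL => _ [m Lm] [C1 [C2 [C3 [C4 [C5 [[c1 c2 c3 c4 c5] L1 L3 _ L5]]]]]].
case: hF => _ [F1 [F2 [F3 [[f1 f2 f3] Fb Fl Fs]]]].
case: hG => _ [G1 [G2 [G3 [[g1 g2 g3] Gb Gl Gs]]]].
(* BL bounds L from below everywhere, and from above at the zero control *)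
pose BL := `|m| + C2.
pose KL := C3 * (1 + Cb ^+ 2).
pose SL := 2 * (C5 * (1 + Cb ^+ 2)).
pose K := G2 + T * (KL + F2).
pose C := G3 + T * (SL + F3).
have Cb2 : 0 <= 1 + Cb ^+ 2 by rewrite addr_ge0// sqr_ge0.
have KL0 : 0 <= KL by rewrite mulr_ge0// ltW.
have SL0 : 0 <= SL by rewrite mulr_ge0// mulr_ge0// ltW.
have BL0 : 0 <= BL by rewrite addr_ge0// ltW.
have K0 : 0 <= K by rewrite addr_ge0 ?mulr_ge0 ?addr_ge0// ltW.
have C0 : 0 <= C by rewrite addr_ge0 ?mulr_ge0 ?addr_ge0// ltW.
pose A := partials_mass rho.
pose P := 2 * C + 2 * (d%:R * C) + 2 * (d%:R ^+ 2 * (K * A 1)) +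
  2 * (d%:R ^+ 2 * (K * A 3)).
have P0 : 0 < P.
  have Cgt0 : 0 < C by rewrite ltr_pwDl// mulr_ge0 ?addr_ge0// ltW.
  rewrite /P -!addrA ltr_pwDl ?mulr_gt0//.
  by rewrite ?addr_ge0// mulr_ge0// mulr_ge0 ?sqr_ge0// ?mulr_ge0//
    ?partials_mass_ge0// ltW.
exists P => // mu cmu dt dx eps N dt0 dx0 /andP[eps0 eps1] N1 TN t t01.
have L_lower x a : - BL <= L x a.
  rewrite (le_trans _ (Lm x a))// /BL lerNl.
  by rewrite (le_trans (ler_norm _))// normrN lerDl ltW.
have L_upper0 x : L x 0 <= BL.
  have -> : 0 = 0 *: (0 : 'rV[R]_d) by rewrite scale0r.
  rewrite (le_trans (L1 _ _))// enormZ normr0 mul0r expr0n mulr0 add0r.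
  by rewrite /BL lerDr.
have sq a : enorm a <= Cb -> 1 + enorm a ^+ 2 <= 1 + Cb ^+ 2.
  by move=> aCb; rewrite lerD2l ler_sqr ?nnegrE ?enorm_ge0// (le_trans (enorm_ge0 a)).
have L_lip x a l : enorm a <= Cb -> `|L (x + dx *: ebase R l) a - L x a| <= KL * dx.
  move=> aCb; apply: (coord_difference_le_grad (f := L ^~ a)) => //.
    exact: ltW.
  by move=> y; rewrite (le_trans (L3 _ _))// ler_pM2l// sq.
have L_semi x a h : enorm a <= Cb ->
    L (x + h) a - 2 * L x a + L (x - h) a <= SL * enorm h ^+ 2.
  move=> aCb; rewrite /SL -mulrA.
  apply: (second_difference_le_hessian (f := L ^~ a)).
  - by split.
  - by rewrite mulr_ge0 ?sqr_ge0// mulr_ge0// ltW.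
  - move=> y; rewrite (le_trans (L5 _ _ _))// ler_wpM2r ?sqr_ge0//.
    by rewrite ler_pM2l// sq.
have Fs' x h nu : F (x + h) nu - 2 * F x nu + F (x - h) nu <= F3 * enorm h ^+ 2.
  exact: Fs.
have Gs' x h nu : G (x + h) nu - 2 * G x nu + G (x - h) nu <= G3 * enorm h ^+ 2.
  exact: Gs.
(* the number of steps left at time t; at most N whatever t is *)
pose n := (N - Num.truncn (t / dt))%N.
pose phi := v_remaining T L F G Cb mu N dt dx n.
have ndt : n%:R * dt <= T.
  rewrite -ler_pdivlMr// TN ler_nat; exact: leq_subr.
have Cb0 := ltW hCb.
have phi_bnd i : `|phi i| <= G1 + n%:R * (dt * (BL + F1)).
  exact: v_remaining_bounded.
have phi_lip i l : `|phi (i + delta_mx 0 l) - phi i| <= K * dx.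
  have h : `|phi (i + delta_mx 0 l) - phi i| <=
      (G2 + n%:R * (dt * (KL + F2))) * dx.
    exact: (v_remaining_lipschitz T mu N Cb0 dt0 dx0 L_lower L_upper0 L_lip Fb Fl Gb Gl).
  rewrite (le_trans h)//.
  by rewrite ler_pM2r// lerD2l mulrA ler_wpM2r// addr_ge0// ltW.
have phi_semi i j : phi (i + j) - 2 * phi i + phi (i - j) <=
    C * enorm (grid_point dx j) ^+ 2.
  have h : phi (i + j) - 2 * phi i + phi (i - j) <=
      (G3 + n%:R * (dt * (SL + F3))) * enorm (grid_point dx j) ^+ 2.
    exact: (v_remaining_semiconcave T mu N Cb0 dt0 dx0 L_lower L_upper0 L_semi Fb Fs' Gb Gs').
  rewrite (le_trans h)//.
  by rewrite ler_wpM2r ?sqr_ge0// lerD2l mulrA ler_wpM2r// addr_ge0// ltW.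
rewrite (v_mollified_conv hrho eps0 (fun z => interp1_bounded dx z phi_bnd)).
  exact: (mollified_interp_hessian hrho dx0 eps0 eps1 K0 C0 phi_bnd phi_lip phi_semi).
apply: (@coord_lipschitz_continuous R d _ K) => x l r.
exact: interp1_coord_lipschitz.
Qed.
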